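(* Let $n\ge 2$ and fix $k\ge 1$. The $k$th tensor power of the reflection representation $S_{(n-1,1)}^{\otimes k}$, i.e. the homology module $\tilde H_{k-1}(A^*_{n,k})$, has the following property: the (virtual) module $U_{n,k}:=S_{(n-1,1)}^{\otimes k}\oplus(-1)^k S_{(n-1,1)}$ is a permutation module whose Frobenius characteristic is $h$-positive and supported on the set $\{h_\lambda:\lambda=(n-r,1^r),\ r\ge 2\}$. If $k=1$, then $U_{n,1}=0$. More precisely, the $k$-fold internal product $s_{(n-1,1)}^{*k}$ has the following expansion in homogeneous symmetric functions: $$s_{(n-1,1)}^{*k}=\sum_{d=0}^{n} g_n(k,d)\,h_1^d h_{n-d},$$ where $g_n(k,0)=(-1)^k$, $g_n(k,1)=(-1)^{k-1}$, and $$g_n(k,d)=\sum_{i=d}^{k}(-1)^{k-i}S(i-1,d-1)\quad\text{for } 2\le d\le n.$$ Hence $s_{(n-1,1)}^{*k}=(-1)^{k-1}s_{(n-1,1)}+\mathrm{ch}(U_{n,k})$, where $\mathrm{ch}(U_{n,k})=\sum_{d=2}^n g_n(k,d)h_1^d h_{n-d}$. The integers $g_n(k,d)$ are independent of $n$ for $k\le n$, nonnegative for $2\le d\le k$, and $g_n(k,d)=0$ if $d>k$. Also: (1) $g_n(k,2)=\frac{1+(-1)^k}{2}$; (2) $g_n(k,k-1)=\binom{k-1}{2}-1$ for $k\le n$; (3) $g_n(k,k)=1$ for $k<n$. In particular the coefficient of $h_1^n$ in this expansion of $\mathrm{ch}\,S_{(n-1,1)}^{\otimes k}$ is $g_n(k,n)+g_n(k,n-1)$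 if $k>n$; $\binom{n-1}{2}$ if $k=n$; $1$ if $k=n-1$; and $0$ otherwise.
   Context: $A^*_{n,k}$ is the poset of all words of length at most $k$ (including the empty word, the bottom element) over an alphabet of size $n$, under subword order ($u\le v$ if $u$ is obtained from $v$ by deleting letters), with a top element $\hat 1$ attached; its homology is the reduced homology, with complex coefficients, of the order complex of the nonempty words of length at most $k$, and $S_n$ acts by permuting letters. $S_\lambda$ is the irreducible complex $S_n$-module indexed by $\lambda$, with Frobenius characteristic the Schur function $s_\lambda$; $\mathrm{ch}$ denotes the Frobenius characteristic. $*$ is the internal (Kronecker) product of symmetric functions, so $\mathrm{ch}(V\otimes W)=\mathrm{ch}(V)*\mathrm{ch}(W)$, and $f^{*k}$ is the $k$-fold internal product. $h_m$ is the complete homogeneous symmetric function with $h_0=1$, and $h_{(n-r,1^r)}=h_1^r h_{n-r}$, where $r\le n$. ''$h$-positive'' means a nonnegative combination of the $h_\lambda$. A permutation module is one with a basis permuted by $S_n$ (the zero module allowed). $S(m,j)$ is the Stirling number of the second kind. *)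

(* Defs.v *)
From Stdlib Require ClassicalEpsilon.
From HB Require Import structures.
From mathcomp Require Import all_boot all_order all_algebra all_fingroup.
From mathcomp Require Import all_character.
From mathcomp Require Import reals complex mpoly.

Set Implicit Arguments.
Unset Strict Implicit.
Unset Printing Implicit Defensive.

Import Order.TTheory GRing.Theory Num.Theory.
Local Open Scope ring_scope.

(** * Integer partitions *)

Definition is_part (n : nat) (l : seq nat) : bool :=
  [&& sorted geq l, all (leq 1) l & sumn l == n].

Definition intpart (n : nat) : predArgType :=
  {t : n.-bseq 'I_n.+1 | is_part n [seq val a | a <- t]}.

Definition parts (n : nat) (l : intpart n) : seq nat :=
  [seq nat_of_ord a | a <- bseqval (val l)].

(* (n - r, 1^r); for r = n the zero part is dropped, giving (1^n). *)
Definition hook_part (n r : nat) : seq nat :=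
  [seq a <- (n - r)%N :: nseq r 1%N | 0 < a]%N.

(* z_l = \prod_i i^(m_i) m_i! where m_i is the multiplicity of i in l *)
Definition zpart (l : seq nat) : nat :=
  (\prod_(i <- undup l) (i ^ count_mem i l * (count_mem i l)`!))%N.

(** * Symmetric functions

   Homogeneous symmetric functions of degree n are represented by symmetric
   polynomials in N variables; for N >= n this loses no information. *)

Section SymmetricFunctions.

Variables (F : numFieldType) (N : nat).
Implicit Types (f g : {mpoly F[N]}) (l : seq nat).

Definition psym (m : nat) : {mpoly F[N]} := \sum_(i < N) 'X_i ^+ m.

Definition hsym (m : nat) : {mpoly F[N]} :=
  \sum_(u : 'X_{1..N < m.+1} | mdeg u == m) 'X_[u].

Definition psymp l : {mpoly F[N]} := \prod_(a <- l) psym a.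
Definition hsymp l : {mpoly F[N]} := \prod_(a <- l) hsym a.

Definition cell l : predArgType :=
  {c : 'I_(size l) * 'I_(head 0%N l) | (c.2 < nth 0 l c.1)%N}.

Definition semistandard l (T : {ffun cell l -> 'I_N}) : bool :=
  [forall c : cell l, forall d : cell l,
     (((val c).1 == (val d).1) && ((val c).2 <= (val d).2)%N ==> (T c <= T d)%N)
     && (((val c).2 == (val d).2) && ((val c).1 < (val d).1)%N
           ==> (T c < T d)%N)].

Definition schur l : {mpoly F[N]} :=
  \sum_(T : {ffun cell l -> 'I_N} | semistandard T) \prod_(c : cell l) 'X_(T c).

(* Coordinates of f, homogeneous symmetric of degree n, on the power sums;
   they exist and are unique when n <= N. *)
Definition pcoord (n : nat) f : {ffun intpart n -> F} :=
  ClassicalEpsilon.epsilon (inhabits 0)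
    (fun a : {ffun intpart n -> F} => f = \sum_(l : intpart n) a l *: psymp (parts l)).

(* Internal product in degree n: p_l * p_m = z_l p_l if l = m, else 0. *)
Definition kron (n : nat) f g : {mpoly F[N]} :=
  \sum_(l : intpart n)
    ((zpart (parts l))%:R * pcoord n f l * pcoord n g l) *: psymp (parts l).

(* f * (f * ( ... * f)) with k >= 1 factors *)
Definition kron_pow (n : nat) f (k : nat) : {mpoly F[N]} :=
  iterop k (kron n) f (hsym n).

Definition h_positive_on (n : nat) (P : seq nat -> Prop) f : Prop :=
  exists c : intpart n -> F,
    [/\ forall l : intpart n, 0 <= c l,
        forall l : intpart n, c l != 0 -> P (parts l)
      & f = \sum_(l : intpart n) c l *: hsymp (parts l)].

End SymmetricFunctions.

(** * Modules over the symmetric group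

   MathComp representations act on row vectors on the right, and
   (s * t) i = t (s i) for permutations; all actions below map the basis
   vector e_x to e_(s x). *)

Notation Smodule F n := (representation F [set: 'S_n]%G).

Section Modules.

Variable F : numFieldType.

Definition tensor_grepr (n : nat) (V W : Smodule F n) : Smodule F n :=
  Representation (prod_repr V W).

Lemma triv_mx_repr (n : nat) :
  mx_repr [set: 'S_n]%G (fun _ : 'S_n => 1%:M : 'M[F]_1).
Proof. by split=> // s t _ _; rewrite mulmx1. Qed.

Definition triv_grepr (n : nat) : Smodule F n :=
  Representation (MxRepresentation (triv_mx_repr n)).

Definition tensor_pow (n : nat) (V : Smodule F n) (k : nat) : Smodule F n :=
  iterop k (@tensor_grepr n) V (triv_grepr n).

Lemma perm_mx_repr (n : nat) :
  mx_repr [set: 'S_n]%G (fun s : 'S_n => perm_mx s : 'M[F]_n).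
Proof. by split=> [|s t _ _]; [exact: perm_mx1 | exact: perm_mxM]. Qed.

Definition natural_repr (n : nat) : mx_representation F [set: 'S_n]%G n :=
  MxRepresentation (perm_mx_repr n).

Lemma sum_zero_module (n : nat) :
  mxmodule (natural_repr n) (kermx (const_mx 1 : 'cV[F]_n)).
Proof.
apply/mxmoduleP=> s _; apply/sub_kermxP; rewrite -mulmxA.
suff -> : natural_repr n s *m const_mx 1 = (const_mx 1 : 'cV[F]_n).
  by rewrite mulmx_ker.
by rewrite /= -row_permE; apply/matrixP=> i j; rewrite !mxE.
Qed.

(* S_(n-1,1), as the vectors of F^n with coordinate sum zero *)
Definition reflection (n : nat) : Smodule F n :=
  Representation (submod_repr (sum_zero_module n)).

Definition is_permutation_module (n : nat) (V : Smodule F n) : Prop :=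
  exists2 B : 'M[F]_(rdegree V), B \in unitmx
    & forall (s : 'S_n) i, exists j, row i B *m V s = row j B.

(* Frobenius characteristic: the average of tr(s) p_(cycle type of s) *)
Definition ch (N n : nat) (V : Smodule F n) : {mpoly F[N]} :=
  (n`!)%:R^-1 *: \sum_(s : 'S_n) \tr (V s) *: \prod_(O in porbits s) psym F N #|O|.

(** Virtual modules: the pair (A, B) stands for [A] - [B]. *)

Definition vmodule (n : nat) : Type := (Smodule F n * Smodule F n)%type.

Definition veq (n : nat) (u v : vmodule n) : Prop :=
  mx_rsim (dadd_grepr u.1 v.2) (dadd_grepr v.1 u.2).

Definition vmod (n : nat) (V : Smodule F n) : vmodule n := (V, @grepr0 F _ [set: 'S_n]%G).
Definition vzero (n : nat) : vmodule n := vmod (@grepr0 F _ [set: 'S_n]%G).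
Definition vopp (n : nat) (u : vmodule n) : vmodule n := (u.2, u.1).
Definition vadd (n : nat) (u v : vmodule n) : vmodule n :=
  (dadd_grepr u.1 v.1, dadd_grepr u.2 v.2).
Definition vch (N n : nat) (u : vmodule n) : {mpoly F[N]} := ch N u.1 - ch N u.2.

Definition U_ (n k : nat) : vmodule n :=
  vadd (vmod (tensor_pow (reflection n) k))
       (iter k (@vopp n) (vmod (reflection n))).

End Modules.

(** * Homology of the subword order *)

Section SubwordOrder.

Variables (F : numFieldType) (n k : nat).

Definition subword_lt (u v : k.-bseq 'I_n) : bool := subseq u v && (u != v).

(* chains with j elements of nonempty words of length at most k, that is,
   (j-1)-dimensional simplices of the order complex *)
Definition is_chain (c : seq (k.-bseq 'I_n)) : bool :=
  all (fun w : k.-bseq 'I_n => 0 < size w)%N c && sorted subword_lt c.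

Definition chain (j : nat) : predArgType := {c : j.-tuple (k.-bseq 'I_n) | is_chain c}.

Definition act_word (s : 'S_n) (w : k.-bseq 'I_n) : k.-bseq 'I_n :=
  [bseq of [seq s a | a <- w]].

Lemma act_word_inj (s : 'S_n) : injective (act_word s).
Proof.
by move=> u v /(congr1 val) /= /(inj_map perm_inj) H; apply: val_inj.
Qed.

Lemma act_chain_subproof (s : 'S_n) (j : nat) (c : chain j) :
  is_chain [seq act_word s w | w <- val c].
Proof.
have /andP[pos srt] := valP c; apply/andP; split.
  rewrite all_map; apply: sub_all pos => w /=; by rewrite size_map.
rewrite sorted_map; apply: sub_sorted srt => u v /= /andP[suv nuv].
by rewrite /subword_lt /= map_subseq //= (inj_eq (@act_word_inj s)).
Qed.

Definition act_chain (s : 'S_n) (j : nat) (c : chain j) : chain j :=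
  exist (fun c : j.-tuple _ => is_chain c)
        [tuple of [seq act_word s w | w <- val c]] (act_chain_subproof s c).

Lemma act_chain1 (j : nat) (c : chain j) : act_chain 1%g c = c.
Proof.
apply: val_inj; apply: val_inj => /=; rewrite -[RHS]map_id.
apply: eq_map => w; apply: val_inj => /=; rewrite -[RHS]map_id.
by apply: eq_map => a; rewrite perm1.
Qed.

Lemma act_chainM (s t : 'S_n) (j : nat) (c : chain j) :
  act_chain (s * t)%g c = act_chain t (act_chain s c).
Proof.
apply: val_inj; apply: val_inj => /=; rewrite -map_comp.
apply: eq_map => w; apply: val_inj => /=; rewrite -map_comp.
by apply: eq_map => a; rewrite permM.
Qed.

Lemma act_chain_inj (s : 'S_n) (j : nat) : injective (@act_chain s j).
Proof.
apply: (can_inj (g := @act_chain s^-1%g j)) => c.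
by rewrite -act_chainM mulgV act_chain1.
Qed.

Definition chain_mx (j : nat) (s : 'S_n) : 'M[F]_#|chain j| :=
  \matrix_(a, b) (enum_val b == act_chain s (enum_val a))%:R.

Lemma chain_mx_mul (j m : nat) (s : 'S_n) (M : 'M[F]_(#|chain j|, m)) a b :
  (chain_mx j s *m M) a b = M (enum_rank (act_chain s (enum_val a))) b.
Proof.
rewrite mxE (bigD1 (enum_rank (act_chain s (enum_val a)))) //= big1 ?addr0.
  by rewrite mxE enum_rankK eqxx mul1r.
move=> i ne; rewrite mxE; case: eqP => [E|_]; last by rewrite mul0r.
by rewrite -E enum_valK eqxx in ne.
Qed.

Lemma chain_mx_repr (j : nat) : mx_repr [set: 'S_n]%G (chain_mx j).
Proof.
split=> [|s t _ _]; apply/matrixP=> a b.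
  by rewrite !mxE act_chain1 (inj_eq enum_val_inj) eq_sym.
by rewrite chain_mx_mul !mxE enum_rankK act_chainM.
Qed.

(* the chain module C_(j-1) *)
Definition chain_repr (j : nat) :
    mx_representation F [set: 'S_n]%G #|chain j| :=
  MxRepresentation (chain_mx_repr j).

Definition delete (T : Type) (i : nat) (c : seq T) : seq T :=
  take i c ++ drop i.+1 c.

(* the boundary map C_j -> C_(j-1), acting on row vectors; C_(-1) is spanned
   by the empty chain, so that boundary 0 is the augmentation *)
Definition boundary (j : nat) : 'M[F]_(#|chain j.+1|, #|chain j|) :=
  \matrix_(a < #|chain j.+1|, b < #|chain j|) \sum_(i < j.+1)
    (-1) ^+ i *
    (tval (val (enum_val b)) == delete i (tval (val (enum_val a))))%:R.

Lemma boundary_equivariant (j : nat) (s : 'S_n) :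
  chain_mx j.+1 s *m boundary j = boundary j *m chain_mx j s.
Proof.
apply/matrixP=> a b; rewrite chain_mx_mul [RHS]mxE.
pose b' := enum_rank (act_chain s^-1%g (enum_val b)).
have eb : act_chain s (enum_val b') = enum_val b.
  by rewrite enum_rankK -act_chainM mulVg act_chain1.
rewrite (bigD1 b') //= big1 ?addr0 => [|i ne]; last first.
  rewrite [X in _ * X]mxE -eb (inj_eq (@act_chain_inj s j)).
  by rewrite (inj_eq enum_val_inj) eq_sym (negPf ne) mulr0.
rewrite [X in _ * X]mxE eb eqxx mulr1 !mxE; apply: eq_bigr => i _.
rewrite enum_rankK -eb /= /delete -map_take -map_drop -map_cat.
by rewrite (inj_eq (inj_map (@act_word_inj s))).
Qed.

Lemma cycles_module (j : nat) :
  mxmodule (chain_repr j.+1) (kermx (boundary j)).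
Proof.
apply/mxmoduleP=> s _; apply/sub_kermxP.
by rewrite -mulmxA boundary_equivariant mulmxA mulmx_ker mul0mx.
Qed.

Lemma boundaries_module (j : nat) :
  mxmodule (chain_repr j) <<boundary j>>%MS.
Proof.
rewrite (eqmx_module _ (genmxE _)); apply/mxmoduleP=> s _.
by rewrite -boundary_equivariant submxMl.
Qed.

(* reduced homology in degree i >= 0: the image of the cycles in the quotient
   of the chain module by the boundaries *)
Definition homology (i : nat) : Smodule F n :=
  Representation (section_repr (boundaries_module i.+1) (cycles_module i)).

End SubwordOrder.

(** * The coefficients g_n(k, d) *)

(* partitions of an m-element set into j nonempty blocks *)
Definition stirling2 (m j : nat) : nat :=
  #|[set P : {set {set 'I_m}} | partition P [set: 'I_m] && (#|P| == j)]|.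

(* set to 0 for d > n, outside the range of summation *)
Definition g_ (n k d : nat) : int :=
  if d == 0%N then (-1) ^+ k
  else if d == 1%N then (-1) ^+ k.-1
  else if (d <= n)%N then
    \sum_(d <= i < k.+1) (-1) ^+ (k - i) * (stirling2 i.-1 d.-1)%:Z
  else 0.

(* Main.v *)
(** Write nu(w) for the alternating sum of the words obtained from w by deleting
   one letter; nu o nu = 0.  A tensor t in S^{\otimes k}, seen as a function on
   words of length k all of whose one-coordinate sums vanish, yields the top
   cycle w_1 < ... < w_k |-> t(w_k) * prod_j eta(w_{j-1}, w_j), where eta is the
   matrix of nu: nu o nu = 0 kills the faces omitting w_j, j < k, and the
   vanishing sums kill the face omitting w_k.  On the chain of prefixes of a
   Smirnov word w (no two equal adjacent letters) the value is +- t(w), and a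
   tensor of S^{\otimes k} vanishing on Smirnov words is 0, so this map is
   injective.  Conversely a top cycle is determined by its values on the prefix
   chains of the (n-1)^k Smirnov words not ending with a fixed letter, so the map
   is an isomorphism by dimension.

   The remaining claims are about characters.  With x the number of fixed points,
   the character of S^{\otimes k} is (x - 1)^k = sum_d g(k,d) x(x-1)...(x-d+1),
   by the recursion g(k+1,d) = S(k,d-1) - g(k,d), and the d-th falling factorial is
   the character of the permutation module on injective words of length d, whose
   Frobenius characteristic is h_1^d h_{n-d}.  Modules with equal traces are
   isomorphic, which gives U_{n,k}.  The internal product is computed on power
   sums; the class sizes n!/z_l come from comparing the cycle index with
   h_n = sum_l p_l / z_l.  Finally, the coefficient of h_1^n is read off at a point
   where p_j = (-1)^{j-1} for j <= n, so that h_1 = 1 and h_m = 0 for 2 <= m <= n. *)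

Require Import Defs.
From HB Require Import structures.
From mathcomp Require Import all_boot all_order all_algebra all_fingroup.
From mathcomp Require Import all_character.
From mathcomp Require Import reals complex mpoly.
From mathcomp Require Import all_solvable all_field ring lra zify.

Set Implicit Arguments.
Unset Strict Implicit.
Unset Printing Implicit Defensive.

Import Order.TTheory GRing.Theory Num.Theory.
Local Open Scope ring_scope.

(** * Stirling numbers and the coefficients g_n(k, d) *)

(** Functions with kernel [P] correspond, through [lift_blk], to injective maps from the blocks of
    [P] into ['I_y]. *)
Lemma card_preim_partition (m y : nat) (P : {set {set 'I_m}}) :
  partition P [set: 'I_m] ->
  #|[set f : {ffun 'I_m -> 'I_y} | preim_partition f [set: 'I_m] == P]|
    = (y ^_ #|P|)%N.
Proof.
move=> partP; have [/eqP covP trivP P0] := and3P partP.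
have memP x : pblock P x \in P by rewrite pblock_mem // covP inE.
pose blk x : {A | A \in P} := exist _ (pblock P x) (memP x).
have blk_surj (A : {A | A \in P}) : exists x, blk x == A.
  have [A0|[x xA]] := set_0Vmem (val A).
    by case/negP: P0; rewrite -A0; exact: (valP A).
  by exists x; apply/eqP/val_inj; rewrite /= (def_pblock trivP (valP A) xA).
pose lift_blk (g : {ffun {A | A \in P} -> 'I_y}) := [ffun x => g (blk x)].
have lift_inj : injective lift_blk.
  move=> g h /ffunP e; apply/ffunP=> A; have [x /eqP<-] := blk_surj A.
  by have:= e x; rewrite !ffunE.
rewrite -[X in (X ^_ _)%N](card_ord y) -[#|P|](card_sig (fun A => A \in P)) -card_inj_ffuns.
rewrite -(card_imset _ lift_inj); congr #|pred_of_set _|.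
apply/setP=> f; rewrite inE; apply/eqP/imsetP => [eP|[g]]; last first.
  rewrite inE => /injectiveP ginj ->; rewrite -[RHS](preim_partition_pblock partP).
  rewrite /preim_partition /equivalence_partition; apply: eq_imset => x.
  apply/setP=> z; rewrite !inE !ffunE.
  by apply/eqP/eqP => [/ginj []//|e]; congr (g _); apply: val_inj.
have fE x z : (f x == f z) = (pblock P x == pblock P z).
  have := @pblock_equivalence_partition _ (fun x z => f x == f z) [set: 'I_m].
  rewrite -[equivalence_partition _ _]/(preim_partition f [set: 'I_m]) eP.
  move=> E; rewrite eq_pblock ?covP ?inE // E ?inE // => ? ? ? _ _ _.
  by split=> // /eqP->.
pose g := [ffun A : {A | A \in P} => f (xchoose (blk_surj A))].
exists g.
  rewrite inE; apply/injectiveP=> A B; rewrite !ffunE => /eqP; rewrite fE.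
  have /eqP eA := xchooseP (blk_surj A); have /eqP eB := xchooseP (blk_surj B).
  by move=> /eqP e; rewrite -eA -eB; apply: val_inj.
apply/ffunP=> x; rewrite !ffunE; apply/eqP; rewrite fE.
by have /eqP /(congr1 val) /= -> := xchooseP (blk_surj (blk x)).
Qed.

(** Classify the functions from ['I_m] to ['I_y] by their kernel, and the kernels by their number of
    blocks, which is at most [m]. *)
Lemma expn_stirling2 (m y : nat) :
  (y ^ m = \sum_(j < m.+1) stirling2 m j * y ^_ j)%N.
Proof.
transitivity #|{: {ffun 'I_m -> 'I_y}}|; first by rewrite card_ffun !card_ord.
have card_le (P : {set {set 'I_m}}) : partition P [set: 'I_m] -> (#|P| < m.+1)%N.
  move=> pP; rewrite ltnS -[m in (_ <= m)%N](card_ord m) -cardsT.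
  rewrite (card_partition pP) -sum1_card leq_sum // => A AP.
  rewrite card_gt0; apply: contraTneq AP => ->.
  by case/and3P: pP.
rewrite -sum1_card.
rewrite (partition_big (fun f : {ffun 'I_m -> 'I_y} => preim_partition f [set: 'I_m])
  (fun P => partition P [set: 'I_m])) /=; last by move=> f _; apply: preim_partitionP.
under eq_bigr => P pP.
  rewrite (_ : (\sum_(_ | _) _)%N = (y ^_ #|P|)%N); last first.
    rewrite -(card_preim_partition y pP) -sum1_card; apply: eq_bigl => f.
    by rewrite !inE.
  over.
rewrite (partition_big (fun P : {set {set 'I_m}} => inord #|P| : 'I_m.+1) xpredT) //=.
apply: eq_bigr => j _; rewrite /stirling2 -sum_nat_const; apply: eq_big => P; rewrite ?inE.
  by apply: andb_id2l => /card_le lP; rewrite -val_eqE /= inordK.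
by case/andP=> /card_le lP /eqP <-; rewrite inordK.
Qed.

Lemma stirling2_small (m j : nat) : (m < j)%N -> stirling2 m j = 0%N.
Proof.
move=> lt_mj; apply/eqP; rewrite cards_eq0; apply/eqP/setP=> P; rewrite !inE.
apply/negP=> /andP[pP /eqP jP]; move: lt_mj; rewrite -jP ltnNge => /negP[].
rewrite -[X in (_ <= X)%N](card_ord m) -cardsT (card_partition pP) -sum1_card.
apply: leq_sum => A AP; rewrite card_gt0; apply: contraTneq AP => ->.
by case/and3P: pP.
Qed.

(** Evaluating at [y = j] makes the system triangular: later terms vanish, earlier ones agree by
    induction, and [j ^_ j] is not zero. *)
Lemma ffact_basis (m : nat) (a b : nat -> nat) :
  (forall y, \sum_(j < m) a j * y ^_ j = \sum_(j < m) b j * y ^_ j)%N ->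
  forall j, (j < m)%N -> a j = b j.
Proof.
move=> eq_ab; elim/ltn_ind=> j IH lt_jm; have := eq_ab j.
rewrite -!(big_mkord xpredT (fun i => _ i * j ^_ i)%N).
rewrite !(big_cat_nat (leq0n j) (ltnW lt_jm)) /= !(big_ltn lt_jm) ffactnn.
rewrite [X in (X + _)%N](eq_big_nat _ _ (F2 := fun i => b i * j ^_ i)%N); last first.
  by move=> i /andP[_ lt_ij]; rewrite IH // (ltn_trans lt_ij).
have tail0 c : (\sum_(j.+1 <= i < m) c i * j ^_ i = 0)%N.
  by rewrite big_nat_cond big1 // => i /andP[/andP[lt_ji _] _]; rewrite ffact_small ?muln0.
move/addnI; rewrite !tail0.
by rewrite !addn0 => /eqP; rewrite eqn_pmul2r ?fact_gt0 // => /eqP.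
Qed.

(* Both sides are the coordinates of y^(m+1) on the falling factorials of y. *)
Lemma stirling2_rec (m j : nat) :
  (stirling2 m.+1 j = j * stirling2 m j + (0 < j) * stirling2 m j.-1)%N.
Proof.
have [lt_jm|lt_mj] := ltnP j m.+2; last first.
  case: j lt_mj => // j lt_mj.
  by rewrite !stirling2_small ?muln0 // ltnW.
apply: (@ffact_basis m.+2 (stirling2 m.+1)
  (fun j => j * stirling2 m j + (0 < j) * stirling2 m j.-1)%N _ j lt_jm) => y.
rewrite -expn_stirling2 expnS expn_stirling2 big_distrr /=.
under [RHS]eq_bigr do rewrite mulnDl.
rewrite big_split [X in _ = (X + _)%N]big_ord_recr /= (@stirling2_small m m.+1) // muln0 mul0n addn0.
rewrite [X in (_ + X)%N]big_ord_recl /= mul0n add0n -big_split /=.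
apply: eq_bigr => i _; rewrite /bump /= mul1n !add0n ?add1n /= ffactnSr.
have [/subnKC {1}<-|/ffact_small->] := leqP i y; last by rewrite !(muln0, mul0n).
ring.
Qed.

Lemma stirling2_0 (m : nat) : stirling2 m.+1 0 = 0%N.
Proof. by rewrite stirling2_rec. Qed.

Lemma stirling2_00 : stirling2 0 0 = 1%N.
Proof. by have := expn_stirling2 0 0; rewrite big_ord1 muln1. Qed.

Lemma stirling2_1 (m : nat) : stirling2 m.+1 1 = 1%N.
Proof.
elim: m => [|m IH]; rewrite stirling2_rec !mul1n ?IH ?stirling2_0 //.
by rewrite stirling2_small ?stirling2_00.
Qed.

Lemma stirling2_diag (m : nat) : stirling2 m m = 1%N.
Proof.
elim: m => [|m IH]; first exact: stirling2_00.
by rewrite stirling2_rec stirling2_small // muln0 mul1n IH.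
Qed.

Lemma stirling2_subdiag (m : nat) : stirling2 m.+1 m = 'C(m.+1, 2).
Proof.
elim: m => [|m IH]; first exact: stirling2_0.
rewrite stirling2_rec stirling2_diag mul1n IH muln1.
by rewrite [in RHS]binS bin1 addnC.
Qed.

Lemma stirling2_mono (m j : nat) : (0 < j)%N -> (stirling2 m j <= stirling2 m.+1 j)%N.
Proof.
by move=> j0; rewrite stirling2_rec (leq_trans _ (leq_addr _ _)) // leq_pmull.
Qed.

Lemma g_0 (n k : nat) : g_ n k 0 = (-1) ^+ k. Proof. by []. Qed.

Lemma g_1 (n k : nat) : g_ n k 1 = (-1) ^+ k.-1. Proof. by []. Qed.

Lemma g_ge2 (n k d : nat) : (2 <= d <= n)%N ->
  g_ n k d = \sum_(d <= i < k.+1) (-1) ^+ (k - i) * (stirling2 i.-1 d.-1)%:Z.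
Proof. by case/andP; case: d => [|[|d]] // _ dn; rewrite /g_ /= dn. Qed.

Lemma g_gtk (n k d : nat) : (0 < k < d)%N -> g_ n k d = 0.
Proof.
case/andP=> k0 lt_kd; rewrite /g_; case: d lt_kd => [|[|d]] //; first by rewrite ltnNge k0.
by move=> lt_kd /=; case: ifP => // _; rewrite big_geq.
Qed.

(** The term [i = k.+1] contributes the Stirling number, and all other signs in the sum flip when
    [k] grows by one. *)
Lemma g_rec (n k d : nat) : (0 < k)%N -> (2 <= d <= n)%N ->
  g_ n k.+1 d = (stirling2 k d.-1)%:Z - g_ n k d.
Proof.
move=> k0 dn; have [le_dk|lt_kd] := leqP d k.+1; last first.
  rewrite !g_gtk ?lt_kd ?k0 ?andbT //; last exact: ltnW.
  by rewrite stirling2_small // -ltnS prednK // (leq_trans _ lt_kd).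
rewrite !g_ge2 // big_nat_recr //= subnn mul1r addrC; congr (_ + _).
rewrite -sumrN !big_nat; apply: eq_bigr => i /andP[_ le_ik].
by rewrite subSn // exprS mulN1r mulNr.
Qed.

Lemma g_diag (n k : nat) : (0 < k <= n)%N -> g_ n k k = 1.
Proof.
case: k => [|[|k]] // /andP[_ kn].
by rewrite g_ge2 // big_nat1 subnn mul1r stirling2_diag.
Qed.

Lemma g_subdiag (n k : nat) : (0 < k <= n)%N -> g_ n k k.-1 = ('C(k.-1, 2))%:Z - 1.
Proof.
case: k => [|[|[|k]]] // /andP[_ kn].
by rewrite g_rec ?g_diag ?stirling2_subdiag ?(ltnW kn).
Qed.

Lemma g_ge0 (n k d : nat) : (0 < k)%N -> (2 <= d)%N -> 0 <= g_ n k d.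
Proof.
move=> k0 d2; have [dn|nd] := leqP d n; last first.
  by case: d d2 nd => [|[|d]] //= _ nd; rewrite /g_ /= leqNgt nd.
(* The upper bound is what makes the difference in [g_rec] nonnegative; it persists because the
   Stirling numbers increase with [k]. *)
suff: 0 <= g_ n k d <= (stirling2 k d.-1)%:Z by case/andP.
have dn2 : (2 <= d <= n)%N by rewrite d2.
case: k k0 => // k _; elim: k => [|k /andP[g0 gS]]; first by rewrite g_gtk.
rewrite g_rec // subr_ge0 gS lerBlDr (le_trans (y := (stirling2 k.+1 d.-1)%:Z)) //.
rewrite -[X in X <= _]addr0 lerD // lez_nat stirling2_mono // -ltnS prednK //.
exact: ltnW.
Qed.

Lemma g_2 (n k : nat) : (2 <= n)%N -> (0 < k)%N ->
  (g_ n k 2)%:~R = (1 + (-1) ^+ k) / 2 :> rat.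
Proof.
move=> n2; case: k => // k _; elim: k => [|k IH].
  by rewrite g_gtk // expr1 subrr mul0r.
rewrite g_rec // rmorphB /= IH stirling2_1 [in RHS]exprS; lra.
Qed.

(** Multiply the expansion of [x ^ m.+1] by [x.+1] and use [x.+1 * x ^_ i = x.+1 ^_ i.+1]. The cut
    at [d = n] loses nothing since [x.+1 <= n]. *)
Lemma expn_pred_stirling2 (n m x : nat) : (x < n)%N ->
  (x.+1 * x ^ m.+1 = \sum_(2 <= d < n.+1) stirling2 m.+1 d.-1 * x.+1 ^_ d)%N.
Proof.
move=> xn; rewrite expn_stirling2 big_ord_recl stirling2_0 mul0n add0n.
rewrite big_add1 big_add1 /= -(big_mkord xpredT (fun i => stirling2 m.+1 i.+1 * x ^_ i.+1)%N).
(* Both sums are extended to the bound [m.+1 + n]; the extra terms vanish, on the left through the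
   Stirling numbers, on the right through the falling factorials. *)
have widen F a b : (a <= b)%N -> (forall i, (a <= i)%N -> F i = 0%N) ->
    (\sum_(0 <= i < a) F i = \sum_(0 <= i < b) F i)%N.
  move=> ab F0; rewrite [RHS](big_cat_nat (leq0n a) ab) /= [X in (_ + X)%N]big_nat_cond.
  by rewrite [X in (_ + X)%N]big1 ?addn0 // => i /andP[/andP[ai _] _]; apply: F0.
rewrite (widen _ _ (m.+1 + n)%N) ?leq_addr //; last first.
  by move=> i mi; rewrite stirling2_small.
rewrite [RHS](widen _ _ (m.+1 + n)%N); last 2 first.
- by rewrite (leq_trans (leq_pred _)) ?leq_addl.
- by move=> i ni; rewrite ffact_small ?muln0 //; case: n xn ni => // n; lia.
by rewrite big_distrr /=; apply: eq_bigr => i _; rewrite ffactSS mulnCA.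
Qed.

(** Induction from (x - 1)^(k+1) = x (x - 1)^k - (x - 1)^k: the first term gives the Stirling part
    of [g_rec] by [expn_pred_stirling2], the second is the induction hypothesis. *)
Lemma expr_pred_ffact (n k x : nat) : (1 <= n)%N -> (0 < k)%N -> (x <= n)%N ->
  (x%:Z - 1) ^+ k = \sum_(0 <= d < n.+1) g_ n k d * (x ^_ d)%:Z.
Proof.
move=> n1 + xn; case: k => // k _; elim: k => [|k IH].
  rewrite big_ltn // big_ltn ?ltnS // ffactn0 ffactn1 big_nat_cond big1.
    by rewrite g_0 g_1 expr1 expr0 mulr1 mul1r addr0 addrC.
  by move=> d /andP[/andP[d1 _] _]; rewrite g_gtk // mul0r.
rewrite exprS [in RHS]big_ltn // [in RHS]big_ltn // ffactn0 ffactn1.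
under [X in _ + (_ + X)]eq_big_nat => d /andP[d2 dn].
  rewrite g_rec ?d2 // mulrBl; over.
rewrite big_split sumrN /=.
have -> : \sum_(2 <= d < n.+1) (stirling2 k.+1 d.-1)%:Z * (x ^_ d)%:Z
    = x%:Z * (x%:Z - 1) ^+ k.+1.
  (* [expn_pred_stirling2] is phrased with the predecessor of [x], so [x = 0] is separate; there
     both sides are zero. *)
  case: x {IH} xn => [|x] xn.
    rewrite mul0r big_nat_cond big1 // => d /andP[/andP[d2 _] _].
    by rewrite ffact_small ?mulr0 // ltnW.
  have -> : x.+1%:Z - 1 = x%:Z by lia.
  rewrite -!natz -natrX -natrM (@expn_pred_stirling2 n) // natr_sum.
  by apply: eq_bigr => d _; rewrite natrM !natz.
have IH' := IH; rewrite [in RHS]big_ltn // [in RHS]big_ltn // ffactn0 ffactn1 in IH'.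
rewrite mulrBl mul1r {2}IH' !g_0 !g_1 /= ![_ ^+ k.+2]exprS ![_ ^+ k.+1]exprS.
ring.
Qed.

(** * Representations with equal traces *)

(** A rank factorization e = C R of an idempotent satisfies R C = 1, and the trace is cyclic. *)
Lemma mxtrace_idempotent (F : fieldType) (n : nat) (e : 'M[F]_n) :
  e *m e = e -> \tr e = (\rank e)%:R.
Proof.
move=> ee; rewrite -{1}(mulmx_base e) mxtrace_mulC -[RHS]mxtrace1; congr (\tr _).
have cb_full : row_full (col_base e) by exact: col_base_full.
have: col_base e *m (row_base e *m col_base e) *m row_base e = col_base e *m 1%:M *m row_base e.
  by rewrite mulmx1 mulmxA mulmx_base -mulmxA mulmx_base ee.
by move/(row_free_inj (row_base_free e))/(row_full_inj cb_full).
Qed.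

(** This carries an equality of characters from the group over to the central idempotents of the
    group ring. *)
Lemma mxtrace_gring_op (F : fieldType) (gT : finGroupType) (G : {group gT}) n
    (rG : mx_representation F G n) A :
  \tr (gring_op rG A) = \sum_i gring_row A 0 i * \tr (rG (enum_val i)).
Proof.
rewrite gring_opE /gring_mx /= mulmx_sum_row !linear_sum; apply: eq_bigr => i _.
by rewrite !linearZ /= rowK mxvecK.
Qed.

Lemma val_submod_gring_op (F : fieldType) (gT : finGroupType) (G : {group gT}) n
    (rG : mx_representation F G n) (U : 'M_n) (modU : mxmodule rG U) A :
  val_submod (gring_op (submod_repr modU) A) = val_submod 1%:M *m gring_op rG A.
Proof.
rewrite !gring_opE /gring_mx /= !mulmx_sum_row !linear_sum; apply: eq_bigr => i _.
rewrite !linearZ /= !rowK !mxvecK -[submod_repr modU _]mul1mx.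
by rewrite (val_submodJ modU) ?enum_valP.
Qed.

Section TraceSimilarity.

Variables (F : numClosedFieldType) (gT : finGroupType) (G : {group gT}).
Let sG : irrType F G := DecSocleType (regular_repr F G).

Lemma num_pchar_pgroup : ([pchar F]^'.-group G)%g.
Proof. by apply/pgroupP=> p _ _; rewrite inE /= [p \in _]pchar_num. Qed.

(** The Wedderburn idempotents sum to the identity, and those of the other components act as zero on
    an irreducible module. *)
Lemma gring_op_irr_comp n (rG : mx_representation F G n) :
  mx_irreducible rG -> gring_op rG (Wedderburn_id (irr_comp sG rG)) = 1%:M.
Proof.
move=> irrG; rewrite -(gring_op1 rG) -(Wedderburn_sum_id_pchar sG num_pchar_pgroup).
rewrite linear_sum (bigD1 (irr_comp sG rG)) //= big1 ?addr0 // => j ne_j.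
exact: (irr_comp'_op0_pchar num_pchar_pgroup irrG ne_j (Wedderburn_id_mem j)).
Qed.

(* The central idempotent attached to M acts on rG1 with nonzero trace, hence on
   rG2 too. *)
Lemma mxtrace_common_simple n1 n2 (rG1 : mx_representation F G n1)
    (rG2 : mx_representation F G n2) (M : 'M_n1) (simM : mxsimple rG1 M) :
    {in G, forall x, \tr (rG1 x) = \tr (rG2 x)} ->
  exists N, exists simN : mxsimple rG2 N,
    mx_rsim (submod_repr (mxsimple_module simM)) (submod_repr (mxsimple_module simN)).
Proof.
move=> eq_tr; pose p'G := num_pchar_pgroup.
have irrM : mx_irreducible (submod_repr (mxsimple_module simM)).
  exact/submod_mx_irr.
pose i := irr_comp sG (submod_repr (mxsimple_module simM)).
have [_ Re idl _] := Wedderburn_is_id_pchar p'G i.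
pose e n (rG : mx_representation F G n) := gring_op rG (Wedderburn_id i).
have ee n (rG : mx_representation F G n) : e n rG *m e n rG = e n rG.
  rewrite -gring_opM ?idl //.
  by rewrite -(Wedderburn_sum_pchar sG p'G) (submx_trans Re) ?(sumsmx_sup i).
have e1_neq0 : e n1 rG1 != 0.
  apply/eqP=> e0; have := val_submod_gring_op (mxsimple_module simM) (Wedderburn_id i).
  rewrite -/(e _ rG1) e0 mulmx0 gring_op_irr_comp // => /eqP.
  rewrite val_submod_eq0 -mxrank_eq0 mxrank1 mxrank_eq0.
  by have [_ /negP] := simM.
have e2_neq0 : e n2 rG2 != 0.
  apply: contraNneq e1_neq0 => e2; rewrite -mxrank_eq0 -(eqr_nat F).
  rewrite -mxtrace_idempotent // /e mxtrace_gring_op.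
  under eq_bigr do rewrite eq_tr ?enum_valP //.
  by rewrite -mxtrace_gring_op -/(e _ rG2) e2 mxtrace0.
(* Some simple summand of [rG2] belongs to the component [i]: otherwise the idempotent would kill
   every summand. *)
have [I W S simW defW _] := dec_mx_reducible_semisimple (mxmodule1 rG2) (mx_Maschke_pchar rG2 p'G).
have [j /eqP ij|noj] := pickP (fun j : I =>
    irr_comp sG (submod_repr (mxsimple_module (simW j))) == i).
  exists (W j), (simW j); apply: mx_rsim_trans (rsim_irr_comp_pchar sG p'G irrM) _.
  rewrite -/i -ij; apply/mx_rsim_sym/rsim_irr_comp_pchar => //.
  exact/submod_mx_irr.
case/eqP: e2_neq0; apply/eqP; rewrite -submx0 -[e n2 rG2]mul1mx -(eqmxMr _ defW).
rewrite sumsmxMr; apply/sumsmx_subP=> j _.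
rewrite -(eqmxMr _ (val_submod1 _)) -(val_submod_gring_op (mxsimple_module (simW j))).
rewrite (@irr_comp'_op0_pchar _ _ _ sG p'G _ _ _ i) ?linear0 ?sub0mx ?Wedderburn_id_mem //.
  exact/submod_mx_irr.
by rewrite eq_sym noj.
Qed.

(** Induction on the dimension: a simple submodule common to both representations is split off by
    Maschke, and the complements again have equal traces. *)
Lemma mxtrace_eq_rsim n1 n2 (rG1 : mx_representation F G n1)
    (rG2 : mx_representation F G n2) :
  {in G, forall x, \tr (rG1 x) = \tr (rG2 x)} -> mx_rsim rG1 rG2.
Proof.
have [m] := ubnP n1; elim: m n1 n2 rG1 rG2 => // m IH n1 n2 rG1 rG2 lt_n1m eq_tr.
have eq_n : n1 = n2.
  apply/eqP; rewrite -(eqr_nat F) -(mxtrace1 F n1) -(mxtrace1 F n2).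
  by rewrite -(repr_mx1 rG1) -(repr_mx1 rG2) eq_tr.
have [n10|n1_gt0] := posnP n1.
  exists 0 => //; first by rewrite /row_free mxrank0 n10.
  by move=> x _; rewrite mulmx0 mul0mx.
have nz1 : (1%:M : 'M[F]_n1) != 0 by rewrite -mxrank_eq0 mxrank1 -lt0n.
have [M simM _] := dec_mxsimple_exists (mxmodule1 rG1) nz1.
have [N [simN rsimMN]] := mxtrace_common_simple simM eq_tr.
have [modM nzM _] := simM.
have [M' modM' defM dxM] := mx_Maschke_pchar rG1 num_pchar_pgroup (mxsimple_module simM) (submx1 M).
have [N' modN' defN dxN] := mx_Maschke_pchar rG2 num_pchar_pgroup (mxsimple_module simN) (submx1 N).
have rsimMN' : mx_rsim (submod_repr modM') (submod_repr modN').
  apply: IH => [|x Gx].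
    rewrite ltnS in lt_n1m; apply: leq_trans lt_n1m.
    rewrite -[X in (_ < X)%N](mxrank1 F) -defM (mxdirectP dxM) /=.
    by rewrite -[X in (X < _)%N]add0n ltn_add2r lt0n mxrank_eq0.
  have := mxtrace_dadd_mod (mxsimple_module simM) modM' (mxmodule1 rG1) defM dxM Gx.
  have := mxtrace_dadd_mod (mxsimple_module simN) modN' (mxmodule1 rG2) defN dxN Gx.
  rewrite (mxtrace_submod1 (mxmodule1 rG1)) // (mxtrace_submod1 (mxmodule1 rG2)) //.
  by rewrite eq_tr // (mxtrace_rsim rsimMN) // => <- /addrI.
pose rM := Representation (submod_repr (mxsimple_module simN)).
pose rM' := Representation (submod_repr modN').
apply: mx_rsim_trans (mx_rsim_sym (rsim_submod1 (mxmodule1 rG1) _)) _ => //.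
apply: mx_rsim_trans (rsim_submod1 (mxmodule1 rG2) _) => //.
apply: mx_rsim_trans (@mx_rsim_dadd _ _ _ _ _ _ _ _ rM rM' _ modM' _ defM dxM rsimMN rsimMN') _.
apply/mx_rsim_sym/(@mx_rsim_dadd _ _ _ _ _ _ _ _ rM rM' (mxsimple_module simN) modN' _ defN dxN); exact: mx_rsim_refl.
Qed.

End TraceSimilarity.

(** * Homology of the subword order *)

Section Deletion.

Variables (T : eqType) (R : fieldType).
Implicit Types (u v w x y : seq T) (phi : seq T -> R).

Lemma delete0 (a : T) w : delete 0 (a :: w) = w.
Proof. by rewrite /delete /= drop0. Qed.

Lemma deleteS i (a : T) w : delete i.+1 (a :: w) = a :: delete i w.
Proof. by []. Qed.

Lemma size_delete i w : (i < size w)%N -> (size (delete i w)).+1 = size w.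
Proof. by move=> iw; rewrite size_cat size_drop size_takel; lia. Qed.

Lemma nth_delete (a : T) i p w : (i < size w)%N ->
  nth a (delete i w) p = nth a w (bump i p).
Proof.
move=> iw; rewrite /delete nth_cat (size_takel (ltnW iw)) /bump; case: (ltnP p i) => pi.
  by rewrite nth_take.
by rewrite nth_drop add1n addSn subnKC.
Qed.

Lemma delete_cat u a v : delete (size u) (u ++ a :: v) = u ++ v.
Proof. by elim: u => [|b u IH] /=; rewrite ?delete0 ?deleteS ?IH. Qed.

Lemma delete_rcons u a : delete (size u) (rcons u a) = u.
Proof. by rewrite -cats1 delete_cat cats0. Qed.

Lemma delete_subseq i w : subseq (delete i w) w.
Proof.
elim: w i => [|a w IH] [|i] //; rewrite ?delete0 ?deleteS ?subseq_cons //=.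
by rewrite eqxx.
Qed.

Lemma subseq_delete u w : subseq u w -> size w = (size u).+1 ->
  exists2 i, (i < size w)%N & u = delete i w.
Proof.
elim: w u => [|a w IH] [|b u] //=; first by move=> _ [/size0nil ->]; exists 0.
case: eqP => [->|_] sub [sz].
  by have [i iw ->] := IH _ sub sz; exists i.+1.
exists 0 => //; rewrite delete0; apply/eqP; rewrite -(size_subseq_leqif sub).
by rewrite sz.
Qed.

Definition cover u v := subseq u v && (size v == (size u).+1).

Lemma coverP u w : reflect (exists2 i, (i < size w)%N & u = delete i w) (cover u w).
Proof.
apply: (iffP andP) => [[sub /eqP sz]|[i iw ->]]; first exact: subseq_delete.
by rewrite delete_subseq size_delete.
Qed.

Arguments coverP {u w}.

(** The linear extension of [phi] evaluated at nu(w); thus [bnd] is the transpose of nu. *)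
Definition bnd phi w : R := \sum_(i < size w) (-1) ^+ i * phi (delete i w).

Lemma bnd_cons phi a w : bnd phi (a :: w) = phi w - bnd (phi \o cons a) w.
Proof.
rewrite /bnd big_ord_recl delete0 mul1r -sumrN; congr (_ + _).
by apply: eq_bigr => i _; rewrite exprS mulN1r mulNr.
Qed.

(** This is nu o nu = 0. In the induction, [bnd_cons] isolates the first letter: deleting it first
    and deleting it second have opposite signs. *)
Lemma bnd_bnd phi w : bnd (bnd phi) w = 0.
Proof.
elim: w phi => [|a w IH] phi; first by rewrite /bnd big_ord0.
rewrite bnd_cons.
have -> : bnd (bnd phi \o cons a) w = bnd phi w - bnd (bnd (phi \o cons a)) w.
  rewrite /bnd -sumrB; apply: eq_bigr => i _.
  by rewrite -mulrBr -bnd_cons.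
by rewrite IH subr0 subrr.
Qed.

(* The signed number of ways of deleting one letter of v to get u. *)
Definition eta u v : R := bnd (fun x => (u == x)%:R) v.

Lemma eta_cover u v : eta u v != 0 -> cover u v.
Proof.
apply: contraR => ncov; rewrite /eta /bnd big1 // => i _.
case: eqP => [e|_]; last by rewrite mulr0.
by case/coverP: ncov; exists i.
Qed.

Fixpoint chain_coef u (s : seq (seq T)) : R :=
  if s is v :: s' then eta u v * chain_coef v s' else 1.

Lemma chain_coef_cat u s1 s2 :
  chain_coef u (s1 ++ s2) = chain_coef u s1 * chain_coef (last u s1) s2.
Proof. by elim: s1 u => [|v s IH] u /=; rewrite ?mul1r // IH mulrA. Qed.

Lemma chain_coef_path u s : chain_coef u s != 0 -> path cover u s.
Proof.
elim: s u => //= v s IH u; have [->|/eta_cover->] := eqVneq (eta u v) 0.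
  by rewrite mul0r eqxx.
have [->|/IH//] := eqVneq (chain_coef v s) 0.
by rewrite mulr0 eqxx.
Qed.

Lemma path_cover_size u s : path cover u s -> size (last u s) = (size u + size s)%N.
Proof.
elim: s u => [|v s IH] u /=; first by rewrite addn0.
by case/andP=> /andP[_ /eqP sv] /IH ->; rewrite sv addSnnS.
Qed.

(** Lengths grow by at least one at every strict step, and the bound on the last length leaves no
    room for a larger step. *)
Lemma path_subword_cover u s :
    path (fun u v => subseq u v && (u != v)) u s ->
    (size (last u s) <= size u + size s)%N ->
  path cover u s.
Proof.
have lt_sz x y : subseq x y && (x != y) -> (size x < size y)%N.
  case/andP=> sub; rewrite ltn_neqAle size_subseq // andbT.
  by rewrite (size_subseq_leqif sub).
have le_last x r : path (fun u v => subseq u v && (u != v)) x r ->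
    (size x + size r <= size (last x r))%N.
  elim: r x => [|y r IH] x /=; first by rewrite addn0.
  by case/andP=> /lt_sz xy /IH; apply: leq_trans; rewrite -addSnnS leq_add2r.
elim: s u => //= v s IH u /andP[uv vs] le_s; have lt_uv := lt_sz _ _ uv.
have := le_last _ _ vs => le_v; rewrite IH //; last by lia.
by case/andP: uv => uv _; rewrite /cover uv andbT; lia.
Qed.

Definition smirnov w := sorted (fun a b => a != b) w.

Lemma smirnovP (a : T) w :
  reflect (forall i, (i.+1 < size w)%N -> nth a w i != nth a w i.+1) (smirnov w).
Proof. exact: sortedP. Qed.

(** Deleting an earlier letter moves letter [i.+1] to position [i], where [u] has a different
    letter. *)
Lemma smirnov_delete u a i : smirnov (rcons u a) -> (i <= size u)%N ->
  (u == delete i (rcons u a)) = (i == size u).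
Proof.
move=> smw; rewrite leq_eqVlt => /predU1P[->|iu].
  by rewrite delete_rcons !eqxx.
rewrite (ltn_eqF iu); apply/eqP=> /(congr1 (nth a ^~ i)).
rewrite nth_delete ?size_rcons ?ltnS ?(ltnW iu) // /bump leqnn add1n.
move/(smirnovP a): smw => /(_ i); rewrite size_rcons ltnS => /(_ iu).
by rewrite nth_rcons iu => /eqP.
Qed.

Lemma eta_rcons u a : smirnov (rcons u a) -> eta u (rcons u a) = (-1) ^+ size u.
Proof.
move=> smw; rewrite /eta /bnd size_rcons big_ord_recr /= delete_rcons eqxx mulr1.
rewrite big1 ?add0r // => i _; rewrite smirnov_delete ?(ltn_eqF (ltn_ord i)) ?mulr0 //.
exact: ltnW.
Qed.

Definition prefixes w := [seq take i.+1 w | i <- iota 0 (size w)].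

Lemma size_prefixes w : size (prefixes w) = size w.
Proof. by rewrite size_map size_iota. Qed.

Lemma prefixes_rcons u a : prefixes (rcons u a) = rcons (prefixes u) (rcons u a).
Proof.
rewrite /prefixes size_rcons -addn1 iotaD map_cat cats1 /= add0n.
rewrite take_oversize ?size_rcons //; congr rcons.
apply/eq_in_map => i; rewrite mem_iota add0n => /andP[_ iu].
by rewrite -cats1 takel_cat.
Qed.

Lemma last_prefixes w : last [::] (prefixes w) = w.
Proof. by case/lastP: w => // u a; rewrite prefixes_rcons last_rcons. Qed.

Lemma chain_coef_prefixes w : smirnov w -> chain_coef [::] (prefixes w) != 0.
Proof.
elim/last_ind: w => [|u a IH] smw; first exact: oner_neq0.
rewrite prefixes_rcons -cats1 chain_coef_cat last_prefixes /= mulr1 eta_rcons //.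
rewrite mulf_neq0 ?signr_eq0 ?IH //.
by move: smw; rewrite -cats1 /smirnov => /cat_sorted2[].
Qed.

End Deletion.

Arguments coverP {T u w}.
Arguments smirnovP {T}.

Lemma sum_bseq1 (T : finType) (R : pzRingType) (k : nat) (phi : seq T -> R) (w : seq T) :
  (size w <= k)%N -> \sum_(v : k.-bseq T) phi v * (val v == w)%:R = phi w.
Proof.
move=> wk; rewrite (bigD1 (Bseq wk)) //= eqxx mulr1 big1 ?addr0 // => v ne.
by case: eqP => [e|_]; rewrite ?mulr0 //; case/eqP: ne; apply: val_inj.
Qed.

(** The one-letter deletions of [w] have length at most [k], so a sum over words of bounded length
    sees all of them. *)
Lemma sum_bseq_eta (T : finType) (F : fieldType) (k : nat) (phi : seq T -> F) (w : seq T) :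
  (size w <= k.+1)%N -> \sum_(v : k.-bseq T) phi v * eta F v w = bnd phi w.
Proof.
move=> wk; rewrite /eta /bnd.
under eq_bigr do rewrite mulr_sumr.
rewrite exchange_big /=; apply: eq_bigr => i _.
rewrite -(@sum_bseq1 _ _ k phi (delete i w)).
  by rewrite mulr_sumr; apply: eq_bigr => v _; rewrite mulrCA.
by rewrite -ltnS size_delete.
Qed.

(** Over ['I_n] this cuts out S^{\otimes k} inside (F^n)^{\otimes k}; only the values of [t] on
    words of length [k] are constrained. *)
Definition zero_sums (T : finType) (R : nmodType) (k : nat) (t : seq T -> R) : Prop :=
  forall x y, (size x + size y).+1 = k -> \sum_(a : T) t (x ++ a :: y) = 0.

(** Sort the words by the position [i] of the deleted letter; for fixed [i] they are the insertions
    of one letter into [u] at [i], and their values sum to zero. *)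
Lemma sum_bseq_zero_sums (T : finType) (F : fieldType) (k : nat) (t : seq T -> F) (u : seq T) :
  zero_sums k t -> (size u).+1 = k -> \sum_(w : k.-bseq T) t w * eta F u w = 0.
Proof.
move=> t0 uk.
transitivity (\sum_(i < k) (-1) ^+ i *
    \sum_(w : k.-bseq T | (size w == k) && (u == delete i w)) t w).
  under [RHS]eq_bigr do rewrite mulr_sumr big_mkcond.
  rewrite exchange_big; apply: eq_bigr => w _ /=.
  have [sw|sw] := eqVneq (size w) k; last first.
    rewrite big1 //; have [->|/eta_cover/andP[_]] := eqVneq (eta F u w) 0.
      by rewrite mulr0.
    by rewrite uk (negPf sw).
  rewrite /eta /bnd -(big_mkord xpredT (fun i => (-1) ^+ i * (u == delete i w)%:R)).
  rewrite sw big_mkord mulr_sumr; apply: eq_bigr => i _.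
  by case: eqP => _; rewrite ?mulr0 // mulr1 mulrC.
rewrite big1 // => i _.
suff -> : \sum_(w : k.-bseq T | (size w == k) && (u == delete i w)) t w
    = \sum_(a : T) t (take i u ++ a :: drop i u).
  by rewrite t0 ?mulr0 // -size_cat cat_take_drop.
have iu : (i <= size u)%N by rewrite -ltnS uk.
have sz a : size (take i u ++ a :: drop i u) = k.
  by rewrite size_cat /= addnS -size_cat cat_take_drop.
have ins_le a : (size (take i u ++ a :: drop i u) <= k)%N by rewrite sz.
pose ins a : k.-bseq T := Bseq (ins_le a).
have ins_inj : injective ins.
  move=> a b /(congr1 val) /= /eqP; rewrite eqseq_cat // eqxx /= => /eqP [].
  by [].
transitivity (\sum_(w in ins @: [set: T]) t (val w)); last first.
  by rewrite big_imset /=; [apply: eq_bigl => a; rewrite inE | move=> a b _ _; exact: ins_inj].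
apply: eq_bigl => w; apply/andP/imsetP => [[/eqP sw /eqP eu]|[a _ ->]]; last first.
  rewrite /= sz; split=> //; rewrite -{1}(cat_take_drop i u).
  by rewrite -{3}(size_takel iu) delete_cat.
case dw : (drop i w) => [|a r].
  by have := size_drop i w; rewrite dw sw /=; have := ltn_ord i; lia.
exists a => //; apply: val_inj => /=.
have ti : size (take i w) = i by rewrite size_takel // sw ltnW.
rewrite -[LHS](cat_take_drop i w) dw eu; congr (_ ++ _ :: _).
  by rewrite /delete take_size_cat.
rewrite /delete drop_size_cat // -[i.+1]add1n -drop_drop dw.
by rewrite /= drop0.
Qed.

Lemma insert_delete (T : Type) (a : T) (i : nat) (c : seq T) : (i < size c)%N ->
  c = take i (delete i c) ++ nth a c i :: drop i (delete i c).
Proof.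
move=> ic; have ti : size (take i c) = i by rewrite size_takel // ltnW.
rewrite /delete take_cat drop_cat ti ltnn subnn take0 drop0 cats0.
by rewrite -drop_nth // cat_take_drop.
Qed.

(** Turns the face relation around: at most one inserted element gives [c] from [b], so the sum has
    at most one nonzero term. *)
Lemma eq_delete_insert (T : finType) (R : pzRingType) (i : nat) (b c : seq T) :
  size c = (size b).+1 -> (i <= size b)%N ->
  (b == delete i c)%:R = \sum_(v : T) (c == take i b ++ v :: drop i b)%:R :> R.
Proof.
move=> sc ib; have ic : (i < size c)%N by rewrite sc ltnS.
case: eqP => [->|ne].
  case: c => // a c in sc ic *; set w := a :: c.
  rewrite (bigD1 (nth a w i)) // -(insert_delete a ic) eqxx big1 /= ?addr0 // => v.
  apply: contraNeq; case: (w =P _) => [e _|_]; last by rewrite eqxx.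
  have ti : size (take i (delete i w)) = i.
    by rewrite size_takel // -ltnS size_delete.
  by rewrite e nth_cat ti ltnn subnn.
rewrite big1 // => v _; case: eqP => // e; case: ne; rewrite e.
by have := delete_cat (take i b) v (drop i b); rewrite size_takel // cat_take_drop.
Qed.

Definition chain_words (n k j : nat) (c : chain n k j) : seq (seq 'I_n) :=
  [seq bseqval w | w <- val c].

(** * Top-dimensional chains and their boundary *)

Section ChainComplex.

Variables (F : numFieldType) (n m : nat).
Let k := m.+1.

(** With the empty word put in front, at least [k] strict steps lead to a word of length at most
    [k], so every step adds exactly one letter. *)
Lemma chain_words_path j (c : chain n k j) : (k <= j)%N ->
  path (@cover _) [::] (chain_words c).
Proof.
move=> kj; have /andP[pos srt] := valP c.
apply: path_subword_cover.
  rewrite /chain_words.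
  case: (tval (val c)) pos srt => //= w s /andP[w0 _] srt; rewrite sub0seq /=.
  rewrite eq_sym -size_eq0 -lt0n w0 /=.
  rewrite path_map; apply: sub_path srt => u v /= /andP[-> ne] /=.
  by apply: contraNneq ne => /val_inj ->.
rewrite size_map size_tuple add0n (leq_trans _ kj) // /chain_words.
case/lastP: (tval (val c)) => // s w.
by rewrite map_rcons last_rcons size_bseq.
Qed.

Lemma is_chain_path (s : seq (k.-bseq 'I_n)) :
  path (@cover _) [::] [seq bseqval w | w <- s] -> is_chain s.
Proof.
case: s => //= w s /andP[/andP[_ /eqP w1]]; rewrite path_map => ws.
rewrite /is_chain /= w1 /=; apply/andP; split; last first.
  apply: sub_path ws => u v /= /andP[uv /eqP sv]; rewrite /subword_lt uv /=.
  by apply: contra_eqN sv => /eqP->; rewrite neq_ltn ltnSn.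
elim: s w {w1} ws => //= v s IH w /andP[/andP[_ /eqP sv] vs].
by rewrite sv /=; apply: (IH v).
Qed.

Lemma chain_eq_empty j : (k < j)%N -> #|chain n k j| = 0%N.
Proof.
move=> kj; apply: eq_card0 => c; have := chain_words_path c (ltnW kj).
move/path_cover_size; rewrite size_map size_tuple add0n => e.
have : (size (last [::] (chain_words c)) <= k)%N.
  rewrite /chain_words; case/lastP: (tval (val c)) => // s w.
  by rewrite map_rcons last_rcons size_bseq.
by rewrite e leqNgt kj.
Qed.

(** A boundary coefficient at [b] becomes a sum over insertions of a word into [b]. Insertions that
    are not chains do no harm, because [f] vanishes on them. *)
Lemma sum_boundary (f : seq (seq 'I_n) -> F) (b : chain n k m) :
    (forall s, size s = k -> f s != 0 -> path (@cover _) [::] s) ->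
  \sum_(c : chain n k k) f (chain_words c)
      * boundary F n k m (enum_rank c) (enum_rank b)
  = \sum_(i < k) (-1) ^+ i * \sum_(v : k.-bseq 'I_n)
      f (take i (chain_words b) ++ bseqval v :: drop i (chain_words b)).
Proof.
move=> f0; under eq_bigr do rewrite mxE !enum_rankK mulr_sumr.
rewrite exchange_big; apply: eq_bigr => i _ /=.
have szb : size (tval (val b)) = m by rewrite size_tuple.
have ib : (i <= size (tval (val b)))%N by rewrite szb -ltnS.
rewrite mulr_sumr.
under eq_bigr => c _.
  rewrite (@eq_delete_insert _ F i (tval (val b)) (tval (val c))) ?ib ?size_tuple //.
  rewrite !mulr_sumr; over.
rewrite exchange_big; apply: eq_bigr => v _ /=.
pose s := take i (tval (val b)) ++ v :: drop i (tval (val b)).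
have ss : size s = k by rewrite size_cat /= addnS -size_cat cat_take_drop szb.
have ms : [seq bseqval w | w <- s] =
    take i (chain_words b) ++ bseqval v :: drop i (chain_words b).
  by rewrite map_cat /= map_take map_drop.
rewrite -ms; have [ch|nch] := boolP (is_chain s); last first.
  rewrite (_ : f _ = 0) ?mulr0; last first.
    by apply: contraNeq nch => /f0 H; apply/is_chain_path/H; rewrite size_map.
  rewrite big1 // => c _; case: eqP => [e|_]; last by rewrite !mulr0.
  by case/negP: nch; have := valP c; rewrite /= e.
pose c0 : chain n k k := exist _ (tcast ss (in_tuple s)) 
  (etrans (congr1 (@is_chain n k) (val_tcast ss (in_tuple s))) ch).
have vc0 : tval (val c0) = s by rewrite /= val_tcast.
rewrite (bigD1 c0) //= big1 ?addr0 => [|c ne].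
  by rewrite val_tcast /= eqxx /chain_words vc0 mulr1 mulrC.
case: eqP => [e|_]; last by rewrite !mulr0.
by case/eqP: ne; apply: val_inj; apply: val_inj; exact: etrans e (esym vc0).
Qed.

End ChainComplex.

(** Take two equal adjacent letters of [w]. A deletion that leaves a Smirnov word must remove one of
    the two, and both choices give the same word. *)
Lemma smirnov_delete_unique (T : eqType) (w v1 v2 : seq T) :
    ~~ smirnov w -> cover v1 w -> cover v2 w -> smirnov v1 -> smirnov v2 ->
  v1 = v2.
Proof.
case: w => [|a w'] //; set w := a :: w' => nsm.
have [p pw /eqP epp] : exists2 p, (p.+1 < size w)%N & nth a w p == nth a w p.+1.
  have [/forallP all_ne|/forallPn[/= p]] := boolP [forall p : 'I_(size w),
      (p.+1 < size w)%N ==> (nth a w p != nth a w p.+1)].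
    case/(smirnovP a): nsm => i iw.
    by have /implyP/(_ iw) := all_ne (Ordinal (ltnW iw)).
  by rewrite negb_imply negbK => /andP[? ?]; exists p.
have del_p v : cover v w -> smirnov v -> v = delete p w.
  case/coverP=> i iw -> /(smirnovP a) sm.
  have sz := size_delete iw.
  have [ip|pi|-> //] := ltngtP i p.
    have := sm p.-1; rewrite !nth_delete //.
    have -> : bump i p.-1 = p by rewrite /bump; lia.
    have -> : bump i p.-1.+1 = p.+1 by rewrite /bump; lia.
    by rewrite epp eqxx; lia.
  have [->|ne] := eqVneq i p.+1.
    apply: (@eq_from_nth _ a) => [|q _].
      by have := size_delete pw; have := size_delete (ltnW pw); lia.
    rewrite !nth_delete ?(ltnW pw) // /bump.
    by case: (ltngtP p q) => // <-; rewrite add0n add1n epp.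
  have := sm p; rewrite !nth_delete // /bump.
  have -> : (i <= p)%N = false by lia.
  have -> : (i <= p.+1)%N = false by lia.
  by rewrite !add0n epp eqxx; lia.
by move=> c1 c2 s1 s2; rewrite (del_p v1) // (del_p v2).
Qed.

(** Otherwise [u] arises from [w] by deleting at [j] and then at some [r]. If [j < r], position [j]
    shows two equal neighbours in [w]; if [r <= j], position [i.-1] shows that the letters of [w] at
    [i.-1] and [i.+1] agree, and these are adjacent once [i] is deleted. *)
Lemma smirnov_delete_cover (T : eqType) (w u : seq T) (b : T) (i j : nat) :
    smirnov w -> rcons u b = delete i w -> smirnov (rcons u b) ->
    (i.+1 < size w)%N -> (j < i)%N ->
  ~~ cover u (delete j w).
Proof.
move=> /(smirnovP b) smw eu /(smirnovP b) smv iw ji.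
have jw : (j < size w)%N by lia.
have szw : size w = (size u).+2 by rewrite -(@size_delete _ i) -?eu ?size_rcons //; lia.
apply/coverP=> -[r].
have := size_delete jw; rewrite szw => -[sx] rx ux.
have nu p : (p < size u)%N -> nth b u p = nth b w (bump i p).
  by move=> pu; rewrite -nth_delete -?eu ?nth_rcons ?pu //; lia.
have nx p : nth b u p = nth b w (bump j (bump r p)).
  by rewrite {1}ux nth_delete // nth_delete.
have [rj|jr] := leqP r j; last first.
  have := nu j; rewrite nx.
  have -> : bump j (bump r j) = j.+1 by rewrite /bump; lia.
  have -> : bump i j = j by rewrite /bump; lia.
  by move=> e; have := smw j; rewrite e ?eqxx; lia.
have := nu i.-1; rewrite nx.
have -> : bump j (bump r i.-1) = i.+1 by rewrite /bump; lia.
have -> : bump i i.-1 = i.-1 by rewrite /bump; lia.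
move=> e; have := smv i.-1; rewrite size_rcons eu !nth_delete; try lia.
have -> : bump i i.-1 = i.-1 by rewrite /bump; lia.
have -> : bump i i.-1.+1 = i.+1 by rewrite /bump; lia.
by rewrite e ?eqxx; lia.
Qed.

Lemma sum_eq0_single (I : finType) (V : nmodType) (f : I -> V) (i : I) :
  \sum_j f j = 0 -> (forall j, j != i -> f j = 0) -> f i = 0.
Proof. by move=> s0 f0; rewrite -s0 (bigD1 i) //= big1 ?addr0. Qed.

(* Y is a top cycle of the open interval below w, up to a scalar determined by the
   chain of prefixes.  By induction only the chains of prefixes of the Smirnov words
   [delete i w] matter; they are treated by decreasing i, exchanging the top element
   of the chain: the other candidates [delete j w] with j < i are excluded by
   smirnov_delete_cover. *)
Lemma cycle_below_eq0 (T : finType) (F : fieldType) (k : nat) (u : seq T) (a : T)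
    (Y : seq (seq T) -> F) :
    let w := rcons u a in
    (size w <= k)%N ->
    (forall s, Y s != 0 -> path (@cover T) [::] (rcons s w)) ->
    (forall p q, (size p + size q).+2 = size w ->
      \sum_(v : k.-bseq T) Y (p ++ bseqval v :: q) = 0) ->
    (smirnov w -> Y (prefixes u) = 0) ->
  forall s, Y s = 0.
Proof.
move=> w; have [l] := ubnP (size u).
elim: l u a Y @w => // l IH u a Y w lt_ul wk supp cyc Y0 s.
apply: contraTeq isT => Ys; have := supp _ Ys.
rewrite rcons_path => /andP[ps /andP[_ /eqP]].
rewrite (path_cover_size ps) add0n size_rcons => -[szs].
case: (lastP s) Ys ps szs => [|{}s v] Ys ps szs.
  have u0 : u = [::] by apply/nilP; rewrite /nilp szs.
  by move: Ys; rewrite -[[::]]/(prefixes [::]) -u0 Y0 ?eqxx // /w u0.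
rewrite size_rcons in szs.
have wsz : size w = (size s).+2 by rewrite size_rcons szs.
(* Fixing the topmost remaining word [x] leaves the same problem one level lower. *)
have IHv x : (smirnov x -> Y (prefixes x) = 0) -> forall r, Y (rcons r x) = 0.
  move=> x0 r; apply: contraTeq isT => Yr; have := supp _ Yr.
  rewrite rcons_path last_rcons => /andP[pr cx].
  have szx : size x = (size s).+1 by case/andP: cx => _ /eqP; rewrite wsz => -[->].
  case/lastP: x x0 Yr pr cx szx => // x b x0 Yr pr cx szx.
  suff: Y (rcons r (rcons x b)) = 0 by move/eqP: Yr.
  apply: (IH x b (fun r => Y (rcons r (rcons x b)))).
  - by move: szx; rewrite size_rcons => -[->]; rewrite -[X in (X <= _)%N]szs.
  - by rewrite szx; apply: ltnW; rewrite -wsz.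
  - by move=> r' /supp; rewrite rcons_path => /andP[].
  - move=> p q pq; under eq_bigr do rewrite rcons_cat rcons_cons.
    by rewrite cyc // wsz size_rcons addnS pq szx.
  - by move=> sx; rewrite -prefixes_rcons x0.
(* The cycle condition at the topmost remaining place: if all chains but one over the same lower
   part vanish, so does that one. *)
have exch x y : size x = size s -> (size y <= k)%N ->
    (forall z, z != y -> Y (rcons (prefixes x) z) = 0) -> Y (rcons (prefixes x) y) = 0.
  move=> szx yk z0.
  apply: (@sum_eq0_single _ _ (fun v : k.-bseq T => Y (rcons (prefixes x) v)) (Bseq yk)).
    have := cyc (prefixes x) [::]; rewrite size_prefixes addn0 szx => /(_ (esym wsz)).
    by under eq_bigr do rewrite cats1.
  by move=> z nez; apply: z0; apply: contraNneq nez => e; apply/eqP/val_inj.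
have noncover y r : ~~ cover y w -> Y (rcons r y) = 0.
  apply: contraNeq => /supp; rewrite rcons_path last_rcons.
  by case/andP.
have cov_rcons y : cover y w -> exists x b, y = rcons x b /\ size x = size s.
  case/andP=> _ /eqP; rewrite wsz; case/lastP: y => // x b; rewrite size_rcons.
  by case=> e; exists x, b.
suff key y : smirnov y -> cover y w -> Y (prefixes y) = 0.
  case/eqP: Ys; have [cv|ncv] := boolP (cover v w); last exact: noncover.
  by apply: IHv => sv; apply: key.
have [smw|nsmw] := boolP (smirnov w) => smy cy; last first.
  have [x [b [ey szx]]] := cov_rcons _ cy; rewrite ey prefixes_rcons -ey.
  apply: exch => // [|z zy].
    by case/andP: cy => /size_subseq/leq_trans->.
  have [cz|ncz] := boolP (cover z w); last exact: noncover.
  apply: IHv => smz; case/eqP: zy.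
  exact: smirnov_delete_unique nsmw cz cy smz smy.
suff del d i : (i <= size u)%N -> (size u - i <= d)%N -> smirnov (delete i w) ->
    Y (prefixes (delete i w)) = 0.
  have /coverP[i iw ey] := cy; rewrite ey in smy *.
  apply: (del (size u - i)%N) smy => //.
  by rewrite -ltnS; move: iw; rewrite size_rcons.
elim: d i => [|d IHd] i iu.
  rewrite leqn0 subn_eq0 => ui; have -> : i = size u by apply/eqP; rewrite eqn_leq iu.
  by rewrite delete_rcons Y0.
have [->|neu] := eqVneq i (size u); first by rewrite delete_rcons Y0.
have {neu}lt_iu : (i < size u)%N by rewrite ltn_neqAle neu.
move=> dui smi; have ci : cover (delete i w) w.
  by apply/coverP; exists i; rewrite // size_rcons ltnS.
have [x [b [ex szx]]] := cov_rcons _ ci; rewrite ex prefixes_rcons -ex.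
apply: exch => // [|z zi].
  by case/andP: ci => /size_subseq/leq_trans->.
have [cz|ncz] := boolP (cover z w); last exact: noncover.
have /coverP[j jw ez] := cz; rewrite size_rcons ltnS in jw.
have [ij|ji|eij] := ltngtP i j; last by rewrite ez eij eqxx in zi.
  by apply: IHv => smz; rewrite ez IHd -?ez // leq_subLR; lia.
apply: contraTeq isT => /supp; rewrite !rcons_path last_prefixes => /andP[/andP[_ cxz] _].
have := @smirnov_delete_cover _ w x b i j smw (esym ex).
by rewrite -ex size_rcons -ez cxz => /(_ smi lt_iu ji).
Qed.

Lemma smirnov_rcons2 (T : eqType) (u : seq T) (a b : T) :
  smirnov (rcons (rcons u a) b) = smirnov (rcons u a) && (a != b).
Proof. by rewrite /smirnov; case: u => [|c u] /=; rewrite ?andbT // rcons_path last_rcons. Qed.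

Lemma delete_rcons_lt (T : Type) (i : nat) (x : seq T) (a : T) : (i < size x)%N ->
  delete i (rcons x a) = rcons (delete i x) a.
Proof.
elim: x i => [|c x IH] [|i] //=; first by rewrite /delete /= !drop0.
by rewrite ltnS => /IH; rewrite /delete /= => ->.
Qed.

(** By [cycle_below_eq0] only the prefix chains of Smirnov words [w] matter. If [w] ends with [a0],
    exchange its top element: another Smirnov word ending with [a0] and covering the same prefix [u]
    would force [u] to end with [a0], so [w] would not be Smirnov. *)
Lemma cycle_eq0 (T : finType) (F : fieldType) (a0 : T) (k : nat) (Z : seq (seq T) -> F) :
    (0 < k)%N ->
    (forall s, Z s != 0 -> size s = k /\ path (@cover T) [::] s) ->
    (forall p q, (size p + size q).+1 = k ->
      \sum_(v : k.-bseq T) Z (p ++ bseqval v :: q) = 0) ->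
    (forall w, size w = k -> smirnov (rcons w a0) -> Z (prefixes w) = 0) ->
  forall s, Z s = 0.
Proof.
move=> k0 supp cyc good0.
have below w : size w = k -> (smirnov w -> Z (prefixes w) = 0) ->
    forall r, Z (rcons r w) = 0.
  case/lastP: w => [k00|u a wk w0]; first by rewrite -k00 in k0.
  apply: (@cycle_below_eq0 _ F k u a (fun r => Z (rcons r (rcons u a)))).
  - by rewrite wk.
  - by move=> r /supp[].
  - move=> p q; rewrite wk => pq; under eq_bigr do rewrite rcons_cat rcons_cons.
    by rewrite cyc // size_rcons addnS.
  - by rewrite -prefixes_rcons.
have size_last r z : Z (rcons r z) != 0 -> size z = k.
  by case/supp => <- /path_cover_size; rewrite last_rcons.
suff key w : size w = k -> smirnov w -> Z (prefixes w) = 0.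
  move=> s; apply/eqP/idPn => Zs; have [sk _] := supp _ Zs.
  case/lastP: s Zs sk => [_ k00|r z Zs _]; first by rewrite -k00 in k0.
  have zk := size_last _ _ Zs.
  by case/eqP: Zs; apply: below => // /key->.
case/lastP: w => [k00|u a wk smw]; first by rewrite -k00 in k0.
have [ea|ne] := eqVneq a a0; last by apply: good0; rewrite // smirnov_rcons2 smw.
have le_wk : (size (rcons u a) <= k)%N by rewrite wk.
rewrite prefixes_rcons.
apply: (@sum_eq0_single _ _ (fun v : k.-bseq T => Z (rcons (prefixes u) v)) (Bseq le_wk)).
  have := cyc (prefixes u) [::]; rewrite size_prefixes addn0 -(size_rcons u a) => /(_ wk).
  by under eq_bigr do rewrite cats1.
move=> z nez; apply/eqP/idPn => Zz; have zk := size_last _ _ Zz.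
case/eqP: (Zz); apply: below => //.
have [x [b ez]] : exists x b, bseqval z = rcons x b.
  by case/lastP: (bseqval z) zk => [zk|x b _]; [rewrite -zk in k0 | exists x, b].
rewrite ez => smz; have [eb|nb] := eqVneq b a0; last first.
  by apply: good0; rewrite -?ez // ez smirnov_rcons2 smz.
have [_] := supp _ Zz; rewrite rcons_path last_prefixes ez => /andP[_ /coverP[i +]].
rewrite size_rcons ltnS leq_eqVlt => /predU1P[->|ix].
  rewrite delete_rcons => eu; case/eqP: nez; apply: val_inj.
  by rewrite /= ez eu ea eb.
rewrite delete_rcons_lt // => eu; move: smw.
by rewrite eu smirnov_rcons2 ea eb eqxx andbF.
Qed.

(** Read from the right, each letter of [t] selects one of the [n] letters different from the next
    one, with [a0] standing after the end. This encodes the Smirnov words not ending with [a0] by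
    arbitrary words over ['I_n]. *)
Fixpoint lift_word (n : nat) (a0 : 'I_n.+1) (t : seq 'I_n) : seq 'I_n.+1 :=
  if t is b :: t' then
    let w := lift_word a0 t' in lift (head a0 w) b :: w
  else [::].

Lemma lift_word_onto (n : nat) (a0 : 'I_n.+1) (w : seq 'I_n.+1) :
  smirnov (rcons w a0) -> exists2 t, size t = size w & lift_word a0 t = w.
Proof.
elim: w => [|a w IH]; first by exists [::].
move=> smw.
have [|t st et] := IH; first by case: (w) smw => //= b w' /andP[].
have : a != head a0 w by case: (w) smw => [|b w'] /= /andP[].
rewrite eq_sym => /unlift_some[b ea _]; exists (b :: t); rewrite /= ?st //.
by rewrite et -ea.
Qed.

(** * Upper bound for the rank of the top cycles *)

Section CycleRank.

Variables (F : numFieldType) (n m : nat).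
Let k := m.+1.

Lemma chain_words_inj j : injective (@chain_words n k j).
Proof. by move=> c d /(inj_map val_inj) e; apply: val_inj; apply: val_inj. Qed.

Lemma is_chain_delete i (s : seq (k.-bseq 'I_n)) : is_chain s -> is_chain (delete i s).
Proof.
case/andP=> pos srt; have sub := delete_subseq i s; apply/andP; split.
  by apply/allP=> w /(mem_subseq sub); apply: (allP pos).
apply: (subseq_sorted _ sub srt) => v u w /andP[uv ne] /andP[vw _].
rewrite /subword_lt (subseq_trans uv vw) /=; apply: contraNneq ne => e.
rewrite -val_eqE /= -(size_subseq_leqif uv) eqn_leq size_subseq //=.
by rewrite e size_subseq.
Qed.

Lemma path_cover_nth (s : seq (seq 'I_n)) u i :
  path (@cover _) u s -> (i < size s)%N -> size (nth [::] s i) = (size u + i.+1)%N.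
Proof.
elim: s u i => //= v s IH u [|i] /andP[/andP[_ /eqP sv] vs] /=.
  by rewrite sv addn1.
by rewrite ltnS => /(IH _ _ vs) ->; rewrite sv addSnnS.
Qed.

(** The vector [z] extended by zero to all sequences of words, so that insertions can be summed
    whether or not they are chains. *)
Definition cycle_fun (z : 'rV[F]_#|chain n k k|) (s : seq (seq 'I_n)) : F :=
  \sum_(c : chain n k k) z 0 (enum_rank c) * (@chain_words n k k c == s)%:R.

Lemma cycle_fun_chain z (c : chain n k k) : cycle_fun z (chain_words c) = z 0 (enum_rank c).
Proof.
rewrite /cycle_fun (bigD1 c) //= eqxx mulr1 big1 ?addr0 // => d /negPf dc.
by rewrite (inj_eq (@chain_words_inj k)) dc mulr0.
Qed.

Lemma cycle_fun_neq0 z s : cycle_fun z s != 0 -> exists c : chain n k k, s = chain_words c.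
Proof.
have [/existsP[c /eqP<-] _|/existsPn nc] := boolP [exists c : chain n k k, @chain_words n k k c == s].
  by exists c.
by rewrite /cycle_fun big1 ?eqxx // => c _; rewrite (negPf (nc c)) mulr0.
Qed.

Lemma cycle_fun_path z s : cycle_fun z s != 0 -> size s = k /\ path (@cover _) [::] s.
Proof.
case/cycle_fun_neq0=> c ->; split; last exact: chain_words_path.
by rewrite size_map size_tuple.
Qed.

(** If some term is nonzero, [p ++ q] is a saturated chain with one word removed. The boundary
    coefficient there is the required sum up to sign, since an insertion at any other place is not
    saturated. *)
Lemma cycle_fun_sum z p q : (z <= kermx (boundary F n k m))%MS ->
    (size p + size q)%N = m ->
  \sum_(v : k.-bseq 'I_n) cycle_fun z (p ++ bseqval v :: q) = 0.
Proof.
move=> /sub_kermxP zb pq.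
have [/existsP[v0 nz0]|/existsPn z0] := boolP [exists v : k.-bseq 'I_n,
    cycle_fun z (p ++ bseqval v :: q) != 0]; last first.
  by rewrite big1 // => v _; apply/eqP; have := z0 v; rewrite negbK.
have [c0 ec0] := cycle_fun_neq0 nz0; have [_ pc0] := cycle_fun_path nz0.
have szc : size (tval (val c0)) = k by rewrite size_tuple.
have szb : size (delete (size p) (tval (val c0))) = m.
  by apply/eqP; rewrite -eqSS size_delete ?szc // ltnS -pq leq_addr.
pose b : chain n k m := exist _ (tcast szb (in_tuple (delete (size p) (tval (val c0)))))
  (etrans (congr1 (@is_chain n k) (val_tcast szb (in_tuple _))) (is_chain_delete _ (valP c0))).
have eb : chain_words b = p ++ q.
  rewrite /chain_words /= val_tcast /= /delete map_cat map_take map_drop.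
  by rewrite -[map _ _]ec0 -[RHS](delete_cat p (bseqval v0)).
have := congr1 (fun M : 'rV_ _ => M 0 (enum_rank b)) zb; rewrite !mxE.
rewrite (reindex_onto enum_rank enum_val) /=; last by move=> i _; rewrite enum_valK.
rewrite (eq_bigl xpredT) => [|c]; last by rewrite enum_rankK eqxx.
under eq_bigr do rewrite -cycle_fun_chain.
rewrite sum_boundary; last by move=> s _ /cycle_fun_path[].
have pk : (size p < k)%N by rewrite ltnS -pq leq_addr.
rewrite (bigD1 (Ordinal pk)) //= eb take_size_cat // drop_size_cat //.
rewrite [X in _ + X]big1 ?addr0 => [/eqP|i ne].
  by rewrite mulf_eq0 signr_eq0 /= => /eqP.
rewrite big1 ?mulr0 // => v _; apply/eqP/idPn => /cycle_fun_path[_ pi].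
have {ne} ne : (i : nat) != size p by apply: contraNneq ne => e; apply/eqP/val_inj.
have lt_ik : (i < k)%N := ltn_ord i.
(* At index [t] the saturated chains with a word inserted at [size p] and at [i] prescribe different
   lengths for the same word of [p ++ q]. *)
pose t := minn i (size p); have tm : (t < m)%N.
  by move: ne lt_ik pk; rewrite /t /k; lia.
have b1 : size (nth [::] (p ++ q) t) = (t + (size p <= t)).+1.
  rewrite -(delete_cat p (bseqval v0)) nth_delete ?size_cat /=; last by lia.
  by rewrite (path_cover_nth pc0) ?size_cat /=; rewrite /bump; lia.
have b2 : size (nth [::] (p ++ q) t) = (t + (i <= t)).+1.
  have ti : size (take i (p ++ q)) = i by rewrite size_takel // size_cat; lia.
  have e : p ++ q = delete i (take i (p ++ q) ++ bseqval v :: drop i (p ++ q)).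
    by have := delete_cat (take i (p ++ q)) (bseqval v) (drop i (p ++ q)); rewrite ti cat_take_drop.
  have szi : size (take i (p ++ q) ++ bseqval v :: drop i (p ++ q)) = k.
    by rewrite size_cat /= addnS -size_cat cat_take_drop size_cat pq.
  rewrite {1}e nth_delete ?szi //.
  rewrite (path_cover_nth pi) ?szi; last by rewrite /bump /k; move: tm; case: (i <= t)%N => /=; lia.
  by rewrite /bump /= add0n addnC.
move: b2; rewrite b1 => -[/eqP]; rewrite eqn_add2l /t.
by move: ne; lia.
Qed.

End CycleRank.

(** [P] evaluates a vector at the prefix chains of the words [lift_word ord0 t]. By [cycle_eq0] it
    is injective on cycles, so the rank is at most its number of columns. *)
Lemma rank_cycles (F : numFieldType) (n m : nat) :
  (\rank (kermx (boundary F n.+1 m.+1 m)) <= n ^ m.+1)%N.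
Proof.
pose P : 'M[F]_(#|chain n.+1 m.+1 m.+1|, #|{: m.+1.-tuple 'I_n}|) :=
  \matrix_(c < #|chain n.+1 m.+1 m.+1|, t < #|{: m.+1.-tuple 'I_n}|)
    (@chain_words n.+1 m.+1 m.+1 (enum_val c)
       == prefixes (lift_word ord0 (tval (enum_val t : m.+1.-tuple 'I_n))))%:R.
have cap0 : (kermx (boundary F n.+1 m.+1 m) :&: kermx P)%MS = 0.
  apply/eqP/rowV0P=> z; rewrite sub_capmx => /andP[zb /sub_kermxP zP].
  suff Z0 s : cycle_fun z s = 0.
    apply/rowP=> c; rewrite mxE -[c]enum_valK -cycle_fun_chain; exact: Z0.
  apply: (@cycle_eq0 _ F ord0 m.+1 (cycle_fun z)) => //.
  - exact: cycle_fun_path.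
  - by move=> p q [pq]; apply: cycle_fun_sum.
  move=> w wk /lift_word_onto[t st <-]; rewrite wk in st.
  have := congr1 (fun M : 'rV_ _ => M 0 (enum_rank (tcast st (in_tuple t)))) zP.
  rewrite !mxE (reindex_onto enum_rank enum_val) /=; last by move=> i _; rewrite enum_valK.
  rewrite (eq_bigl xpredT) => [|c]; last by rewrite enum_rankK eqxx.
  under eq_bigr do rewrite mxE !enum_rankK.
  by rewrite val_tcast.
rewrite -(mxrank_mul_ker _ P) cap0 mxrank0 addn0 (leq_trans (rank_leq_col _)) //.
by rewrite card_tuple card_ord.
Qed.

(* Indices of [tprod]: the pair (i, j) is stored at position i * n + j. *)
Section TensorIndex.

Variable F : fieldType.

Lemma pair_ord_subproof (m n : nat) (i : 'I_m) (j : 'I_n) : (i * n + j < m * n)%N.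
Proof. by rewrite (@leq_trans (i * n + n)) ?ltn_add2l // addnC -mulSn leq_pmul2r //; case: n j => // -[]. Qed.

Definition pair_ord (m n : nat) (i : 'I_m) (j : 'I_n) : 'I_(m * n) :=
  Ordinal (pair_ord_subproof i j).

Lemma pair_ord_bij (m n : nat) : bijective (fun ij : 'I_m * 'I_n => pair_ord ij.1 ij.2).
Proof.
apply: inj_card_bij; last by rewrite card_prod !card_ord.
move=> [i j] [i' j'] /(congr1 val) /= e; have n0 : (0 < n)%N := leq_ltn_trans (leq0n j) (ltn_ord j).
congr (_, _); apply: val_inj.
  by have := congr1 (divn^~ n) e; rewrite !divnMDl // !divn_small ?addn0.
by have := congr1 (modn^~ n) e; rewrite !modnMDl !modn_small.
Qed.

Lemma trow_pair_ord m1 m2 n2 (A : 'rV[F]_m1) (B : 'M[F]_(m2, n2)) i k l :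
  trow A B i (pair_ord k l) = A 0 k * B i l.
Proof.
elim: m1 A k => [|m1 IH] A k; first by case: k.
rewrite /=; have [->|[k' ->]] : k = 0 \/ exists k', k = lift ord0 k'.
- by case: (unliftP ord0 k) => [k'|] ->; [right; exists k'|left].
- rewrite (_ : pair_ord _ l = (lshift (m1 * n2) l : 'I_(m1.+1 * n2))); last exact: val_inj.
  by rewrite row_mxEl !mxE; congr (A _ _ * _); apply: val_inj.
rewrite (_ : pair_ord _ l = (rshift n2 (pair_ord k' l) : 'I_(m1.+1 * n2))).
  by rewrite row_mxEr IH mxE; congr (A _ _ * _); apply: val_inj.
by apply: val_inj; rewrite /= /bump add1n mulSn addnA.
Qed.

Lemma tprod_pair_ord m1 n1 m2 n2 (A : 'M[F]_(m1, n1)) (B : 'M[F]_(m2, n2)) i j k l :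
  tprod A B (pair_ord i j) (pair_ord k l) = A i k * B j l.
Proof.
elim: m1 A i => [|m1 IH] A i; first by case: i.
rewrite /=; have [->|[i' ->]] : i = 0 \/ exists i', i = lift ord0 i'.
- by case: (unliftP ord0 i) => [i'|] ->; [right; exists i'|left].
- rewrite (_ : pair_ord 0 j = (lshift (m1 * m2) j : 'I_(m1.+1 * m2))); last exact: val_inj.
  rewrite col_mxEu trow_pair_ord mxE; congr (A _ _ * _); exact: val_inj.
rewrite (_ : pair_ord _ j = (rshift m2 (pair_ord i' j) : 'I_(m1.+1 * m2))).
  by rewrite col_mxEd IH mxE; congr (A _ _ * _); apply: val_inj.
by apply: val_inj; rewrite /= /bump add1n mulSn addnA.
Qed.

Lemma sum_pair_ord (V : nmodType) (m n : nat) (f : 'I_(m * n) -> V) :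
  \sum_x f x = \sum_(i < m) \sum_(j < n) f (pair_ord i j).
Proof. by rewrite pair_big /= (reindex _ (onW_bij _ (pair_ord_bij m n))). Qed.

End TensorIndex.

(** * The tensor power as a space of functions on words *)

Section WordModel.

Variables (F : numFieldType) (n : nat).
Implicit Types V W : Smodule F n.

(* An embedding of V in (F^n)^{\otimes k}: t i lists the coefficients, on words of
   length k, of the image of the i-th basis vector. *)
Definition word_model k V (t : 'I_(rdegree V) -> seq 'I_n -> F) : Prop :=
  [/\ forall (g : 'S_n) i w, size w = k ->
        \sum_j V g i j * t j w = t i [seq (g^-1)%g a | a <- w],
      forall i, zero_sums k (t i)
    & forall c : 'I_(rdegree V) -> F,
        (forall w, size w = k -> \sum_i c i * t i w = 0) -> forall i, c i = 0].

Lemma reflection_model : exists t, @word_model 1 (reflection F n) t.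
Proof.
pose K := kermx (const_mx 1 : 'cV[F]_n).
exists (fun i w => if w is [:: a] then row_base K i a else 0); split.
- move=> g i [|a [|]] //= _.
  have := val_submodJ (sum_zero_module F n) 1%:M (in_setT g).
  rewrite mul1mx /val_submod /= mul1mx => /(congr1 (fun M : 'M_(_, _) => M i a)).
  rewrite mxE => ->; move: (row_base K) => E.
  rewrite mxE (bigD1 (g^-1 a)%g) //= big1 ?addr0 => [|b ne].
    by rewrite !mxE permKV eqxx mulr1.
  rewrite !mxE (_ : (g b == a) = false) ?mulr0 //.
  by apply: contraNF ne => /eqP <-; rewrite permK.
- move=> i [|? ?] [|? ?] //= _.
  have /sub_kermxP/(congr1 (fun M : 'M_(_, _) => M i 0)) : (row_base K <= K)%MS.
    by rewrite eq_row_base.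
  rewrite !mxE => e0; rewrite -[RHS]e0; apply: eq_bigr => a _.
  by rewrite [const_mx _ _ _]mxE mulr1.
move=> c c0 i; have : (\row_j c j) *m row_base K = 0 *m row_base K.
  rewrite mul0mx; apply/rowP=> a; rewrite mxE [RHS]mxE -[RHS](c0 [:: a]) //.
  by apply: eq_bigr => j _; rewrite mxE.
by move/(row_free_inj (row_base_free K))/rowP/(_ i); rewrite !mxE.
Qed.

(** The model of [V] reads the first letter, that of [W] the remaining [k]. Independence uses that
    of [W] for a fixed index [i], and that of [V] for each fixed remainder of the word. *)
Lemma tensor_model k V W s t : @word_model 1 V s -> @word_model k W t ->
  exists r, @word_model k.+1 (tensor_grepr V W) r.
Proof.
move=> [sg s0 sf] [tg t0 tf].
have [f fK Kf] := pair_ord_bij (rdegree V) (rdegree W).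
pose r x w := s (f x).1 (take 1 w) * t (f x).2 (drop 1 w).
have rE i j w : r (pair_ord i j) w = s i (take 1 w) * t j (drop 1 w).
  by rewrite /r (fK (i, j)).
exists r; split.
- move=> g x w wk; rewrite -(Kf x); move: (f x) => [i j] /=.
  rewrite sum_pair_ord rE -map_take -map_drop -sg; last by rewrite size_takel ?wk.
  rewrite -tg ?size_drop ?wk ?subn1 // big_distrlr /=.
  apply: eq_bigr => i' _; apply: eq_bigr => j' _.
  by rewrite rE tprod_pair_ord mulrACA.
- move=> x [|b u] v /= [szk]; rewrite /r /=.
    under eq_bigr do rewrite drop0 take0.
    by rewrite -mulr_suml (s0 _ [::] [::]) ?mul0r.
  under eq_bigr do rewrite drop0 take0.
  by rewrite -mulr_sumr t0 ?mulr0.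
move=> c c0 x; rewrite -(Kf x); move: (f x) => [i j] /=.
apply: (tf (fun j => c (pair_ord i j))) => w wk.
apply: (sf (fun i => \sum_j c (pair_ord i j) * t j w)) => u u1.
have := c0 (u ++ w); rewrite size_cat u1 wk sum_pair_ord => /(_ erefl) e0.
rewrite -[RHS]e0; apply: eq_bigr => i' _; rewrite mulr_suml; apply: eq_bigr => j' _.
by rewrite rE -u1 take_size_cat // drop_size_cat // mulrAC mulrA.
Qed.

Lemma tensor_pow_model m : exists t, @word_model m.+1 (tensor_pow (reflection F n) m.+1) t.
Proof.
rewrite /tensor_pow iteropS; elim: m => [|m [t tP]]; first exact: reflection_model.
by have [s sP] := reflection_model; apply: tensor_model sP tP.
Qed.

Lemma rdegree_reflection : rdegree (reflection F n.+1) = n.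
Proof.
rewrite /= mxrank_ker; suff -> : \rank (const_mx 1 : 'cV[F]_n.+1) = 1%N by rewrite subn1.
apply/eqP; rewrite eqn_leq rank_leq_col lt0n mxrank_eq0.
by apply/eqP=> /matrixP/(_ 0 0); rewrite !mxE; apply/eqP; rewrite oner_eq0.
Qed.
End WordModel.

Lemma rdegree_tensor_pow (F : numFieldType) (n m : nat) :
  rdegree (tensor_pow (reflection F n.+1) m.+1) = (n ^ m.+1)%N.
Proof.
rewrite /tensor_pow iteropS; elim: m => [|m IH]; first exact: rdegree_reflection.
by rewrite expnS; exact: (congr2 muln (rdegree_reflection F n) IH).
Qed.

(* The proof is by induction on the length of the longest Smirnov prefix: in
   x a a y, replacing the second a by other letters lengthens it. *)
Lemma zero_sums_smirnov_eq0 (T : finType) (R : zmodType) (k : nat) (t : seq T -> R) :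
    zero_sums k t -> (forall w, size w = k -> smirnov w -> t w = 0) ->
  forall w, size w = k -> t w = 0.
Proof.
move=> zs sm0; suff key d w : size w = k -> smirnov (take (k - d) w) -> t w = 0.
  by move=> w wk; apply: (key k); rewrite ?subnn ?take0.
elim: d w => [|d IH] w wk; first by rewrite subn0 -wk take_size; apply: sm0.
have [dk|kd] := ltnP d k; last first.
  have -> : (k - d.+1 = k - d)%N by lia.
  exact: IH.
move=> smw; set p := (k - d.+1)%N in smw.
have pk : (p < size w)%N by rewrite wk /p; lia.
have kdp : (k - d)%N = p.+1 by rewrite /p; lia.
have [a ew] : exists a, w = take p w ++ a :: drop p.+1 w.
  case dw : (drop p w) => [|a r].
    by have := size_drop p w; rewrite dw /= => /esym/eqP; rewrite subn_eq0 leqNgt pk.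
  by exists a; rewrite -[LHS](cat_take_drop p) dw -[p.+1]add1n -drop_drop dw /= drop0.
have tp : size (take p w) = p by rewrite size_takel // ltnW.
have szs : (size (take p w) + size (drop p.+1 w)).+1 = k by rewrite tp size_drop; lia.
have take_ins b : take p.+1 (take p w ++ b :: drop p.+1 w) = rcons (take p w) b.
  by rewrite -cat_rcons take_size_cat // size_rcons tp.
have [sm|nsm] := boolP (smirnov (take p.+1 w)); first by apply: IH; rewrite // kdp.
rewrite ew; apply: (@sum_eq0_single _ _ (fun b => t (take p w ++ b :: drop p.+1 w)) a).
  exact: zs.
move=> b nba; apply: IH; first by rewrite size_cat /= addnS.
rewrite kdp take_ins; move: nsm; rewrite {1}ew take_ins.
case/lastP: (take p w) smw => // u c smu; rewrite !smirnov_rcons2 smu /= negbK.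
by move/eqP->; rewrite eq_sym.
Qed.

(** * The equivariant embedding of the tensor power into the top cycles *)

Section HomologyIso.

Variables (F : numFieldType) (n m : nat).
Let k := m.+1.
Let S := reflection F n.
Variable t : 'I_(rdegree (tensor_pow S k)) -> seq 'I_n -> F.
Hypothesis tP : word_model k t.

Definition psi_fun i (s : seq (seq 'I_n)) : F :=
  t i (last [::] s) * chain_coef F [::] s.

Definition psi : 'M[F]_(rdegree (tensor_pow S k), #|chain n k k|) :=
  \matrix_(i < rdegree (tensor_pow S k), c < #|chain n k k|)
    psi_fun i (@chain_words n k k (enum_val c)).

(** For empty [q] the free word is the top one and the zero sums of [t i] apply; otherwise the two
    factors containing the free word combine to nu o nu = 0. *)
Lemma psi_fun_sum i p q : (size p + size q)%N = m ->
  (forall s, s \in q -> size s <= k)%N ->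
  \sum_(v : k.-bseq 'I_n) psi_fun i (p ++ bseqval v :: q) = 0.
Proof.
move=> pq qk; have [_ t0 _] := tP; rewrite /psi_fun.
under eq_bigr do rewrite last_cat /= chain_coef_cat /=.
case: q pq qk => [|w q] pq qk.
  rewrite addn0 in pq.
  have [->|/chain_coef_path pp] := eqVneq (chain_coef F [::] p) 0.
    by rewrite big1 // => v _; rewrite mul0r mulr0.
  under eq_bigr do rewrite /= mulr1 mulrCA.
  rewrite -mulr_sumr (@sum_bseq_zero_sums _ F k (t i)) ?mulr0 //.
  by rewrite (path_cover_size pp) pq add0n.
under eq_bigr do rewrite /= [eta F _ w * _]mulrC !mulrA.
have -> : \sum_(v : k.-bseq 'I_n) t i (last w q) * chain_coef F [::] p
      * eta F (last [::] p) v * chain_coef F w q * eta F v w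
    = t i (last w q) * chain_coef F [::] p * chain_coef F w q *
      \sum_(v : k.-bseq 'I_n) eta F (last [::] p) v * eta F v w.
  by rewrite mulr_sumr; apply: eq_bigr => v _; ring.
rewrite (@sum_bseq_eta _ F k (eta F (last [::] p))) ?bnd_bnd ?mulr0 //.
by rewrite ltnW // ltnS qk ?mem_head.
Qed.

Lemma psi_cycles : (psi <= kermx (boundary F n k m))%MS.
Proof.
apply/sub_kermxP/matrixP=> i b; rewrite mxE [RHS]mxE.
rewrite (reindex_onto enum_rank enum_val) /=; last by move=> c _; rewrite enum_valK.
rewrite (eq_bigl xpredT) => [|c]; last by rewrite enum_rankK eqxx.
under eq_bigr do rewrite mxE enum_rankK.
rewrite -[b]enum_valK (sum_boundary (f := psi_fun i)) => [|s _]; last first.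
  by rewrite mulf_eq0 negb_or => /andP[_]; apply: chain_coef_path.
rewrite big1 // => j _; set w := chain_words _.
have wk s : s \in w -> (size s <= k)%N by case/mapP=> v _ ->; apply: size_bseq.
rewrite psi_fun_sum ?mulr0 //.
  by rewrite -size_cat cat_take_drop size_map size_tuple.
by move=> s /mem_drop /wk.
Qed.

Lemma chain_prefixes w : size w = k -> smirnov w ->
  exists c : chain n k k, chain_words c = prefixes w.
Proof.
move=> wk smw.
have pw : path (@cover _) [::] (prefixes w).
  exact: chain_coef_path (chain_coef_prefixes F smw).
have le_k s : s \in prefixes w -> (size s <= k)%N.
  by case/mapP=> i _ ->; rewrite -wk size_take_min geq_minr.
pose b : seq (k.-bseq 'I_n) := [seq insub_bseq k s | s <- prefixes w].
have eb : [seq bseqval v | v <- b] = prefixes w.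
  rewrite -map_comp map_id_in // => s /le_k sk /=.
  by rewrite /insub_bseq insubdK.
have szb : size b = k by rewrite size_map size_prefixes.
have chb : is_chain b by apply: is_chain_path; rewrite eb.
exists (exist _ (tcast szb (in_tuple b))
  (etrans (congr1 (@is_chain n k) (val_tcast szb (in_tuple b))) chb)).
by rewrite /chain_words /= val_tcast.
Qed.

(** A combination in the kernel vanishes on prefix chains of Smirnov words, where [chain_coef] is
    nonzero; the tensor is then zero on Smirnov words, hence zero. *)
Lemma psi_free : row_free psi.
Proof.
have [_ t0 tf] := tP.
rewrite -kermx_eq0; apply/rowV0P=> x /sub_kermxP xpsi; apply/rowP=> i.
rewrite [RHS]mxE; apply: (tf (fun i => x 0 i)).
apply: (@zero_sums_smirnov_eq0 _ F k (fun w => \sum_i x 0 i * t i w)).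
  move=> u v uv; rewrite exchange_big big1 //= => j _.
  by rewrite -mulr_sumr t0 ?mulr0.
move=> w wk smw; have [c ec] := chain_prefixes wk smw.
have := congr1 (fun M : 'rV_ _ => M 0 (enum_rank c)) xpsi; rewrite !mxE.
under eq_bigr do rewrite mxE enum_rankK ec /psi_fun last_prefixes mulrA.
rewrite -mulr_suml => /eqP; rewrite mulf_eq0 (negPf (chain_coef_prefixes F smw)) orbF.
by move/eqP.
Qed.

Lemma chain_coef_map (g : 'S_n) u s :
  chain_coef F [seq g a | a <- u] [seq [seq g a | a <- v] | v <- s] = chain_coef F u s.
Proof.
elim: s u => //= v s IH u; rewrite IH; congr (_ * _).
rewrite /eta /bnd size_map; apply: eq_bigr => i _; congr (_ * _%:R).
by rewrite /delete -map_take -map_drop -map_cat (inj_eq (inj_map perm_inj)).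
Qed.

Lemma psi_equivariant g :
  tensor_pow S k g *m psi = psi *m chain_repr F n k k g.
Proof.
have [tg _ _] := tP; apply/matrixP=> i b; rewrite !mxE.
pose c := act_chain g^-1%g (enum_val b : chain n k k).
have ec : act_chain g c = enum_val b by rewrite -act_chainM mulVg act_chain1.
rewrite [RHS](bigD1 (enum_rank c)) //= [X in _ + X]big1 ?addr0 => [|j ne]; last first.
  rewrite [X in _ * X]mxE -ec (inj_eq (@act_chain_inj n k g k)).
  case: eqP => [e|_]; last by rewrite mulr0.
  by rewrite e enum_valK eqxx in ne.
rewrite [X in _ * X]mxE enum_rankK ec eqxx mulr1 mxE enum_rankK.
under eq_bigr do rewrite mxE mulrA.
have wc : chain_words c = [seq [seq g^-1%g a | a <- w] | w <- chain_words (enum_val b : chain n k k)].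
  by rewrite /chain_words /= -!map_comp.
have szl : size (last [::] (chain_words (enum_val b : chain n k k))) = k.
  have /path_cover_size -> := chain_words_path (enum_val b : chain n k k) (leqnn k).
  by rewrite size_map size_tuple.
rewrite -mulr_suml tg // /psi_fun wc; congr (_ * _); last first.
  by rewrite -(chain_coef_map g^-1%g).
by case: (chain_words _) => //= v s; rewrite last_map.
Qed.

End HomologyIso.

(** [psi] is injective into the cycles, whose rank is at most the dimension of the tensor power, so
    it is onto. No chain has [k.+1] words, so the boundaries divided out are zero. *)
Lemma homology_rsim (F : numFieldType) (n m : nat) :
  mx_rsim (homology F n.+1 m.+1 m) (tensor_pow (reflection F n.+1) m.+1).
Proof.
have [t tP] := tensor_pow_model F n.+1 m.
have sub := psi_cycles tP; have free := psi_free tP.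
set k := m.+1 in t tP sub free *; set V := tensor_pow _ k in t tP sub free *.
have eqV : (psi t :=: kermx (boundary F n.+1 k m))%MS.
  apply/eqmxP; rewrite -(geq_leqif (mxrank_leqif_eq sub)) (eqP free).
  by rewrite /V rdegree_tensor_pow rank_cycles.
pose U := (<<boundary F n.+1 k k>>)%MS.
have U0 : U = 0.
  apply/eqP; rewrite -mxrank_eq0 genmxE -leqn0 (leq_trans (rank_leq_row _)) //.
  by rewrite chain_eq_empty.
pose W := (<<in_factmod U (kermx (boundary F n.+1 k m))>>)%MS.
have rk p (A : 'M_(p, _)) : \rank (in_factmod U A) = \rank A.
  have := mxrank_in_factmod U A.
  have -> : \rank U = 0%N by rewrite U0 mxrank0.
  have -> : \rank (U + A) = \rank A by rewrite U0 adds0mx.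
  by rewrite addn0.
have psiW : (in_factmod U (psi t) <= W)%MS by rewrite genmxE submxMr.
apply/mx_rsim_sym; exists (in_submod W (in_factmod U (psi t))) => [||g _].
- by rewrite genmxE rk -eqV (eqP free).
- by rewrite /row_free mxrank_in_submod // rk.
transitivity (in_submod W (in_factmod U (V g *m psi t))).
  by rewrite /in_submod /in_factmod /= !mulmxA.
rewrite (psi_equivariant tP) (in_factmodJ (boundaries_module F n.+1 k k)) ?inE //.
by rewrite -(in_submodJ (section_module (boundaries_module F n.+1 k k) (cycles_module F n.+1 k m))) ?inE.
Qed.

(** * Cycle indices and complete symmetric functions *)

Section FixedColorings.

Variables (n : nat) (C : finType) (R : comPzRingType).

Definition fixes_coloring (s : 'S_n) (f : {ffun 'I_n -> C}) : bool :=
  [forall i, f (s i) == f i].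

Lemma fixes_coloring_porbit s f i j :
  fixes_coloring s f -> j \in porbit s i -> f j = f i.
Proof.
move/forallP=> fs /porbitP[m ->]; elim: m => [|m IH]; first by rewrite expg0 perm1.
by rewrite expgSr permM (eqP (fs _)).
Qed.

(** Expanding the product picks one colour per orbit of [s], that is, a colouring constant on
    orbits. *)
Lemma prod_porbits_coloring (s : 'S_n) (x : C -> R) :
  \prod_(O in porbits s) \sum_c x c ^+ #|O|
    = \sum_(f : {ffun 'I_n -> C} | fixes_coloring s f) \prod_i x (f i).
Proof.
have memO i : porbit s i \in porbits s by apply: imset_f.
rewrite big_enum_val bigA_distr_bigA /=.
have [elt eltP] : exists elt : 'I_#|porbits s| -> 'I_n,
    forall r, porbit s (elt r) = enum_val r.
  have ex_elt (r : 'I_#|porbits s|) : exists i, porbit s i == enum_val r.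
    by have /imsetP[i _ ->] := enum_valP r; exists i.
  by exists (fun r => xchoose (ex_elt r)) => r; exact/eqP/(xchooseP (ex_elt r)).
pose rk i : 'I_#|porbits s| := enum_rank_in (memO i) (porbit s i).
have rkK i : enum_val (rk i) = porbit s i by apply: enum_rankK_in.
have rk_eq i r : (rk i == r) = (i \in enum_val r).
  have /imsetP[j _ ej] := enum_valP r.
  by rewrite -(inj_eq enum_val_inj) rkK ej eq_porbit_mem.
pose h (g : {ffun 'I_#|porbits s| -> C}) : {ffun 'I_n -> C} := [ffun i => g (rk i)].
pose h' (f : {ffun 'I_n -> C}) : {ffun 'I_#|porbits s| -> C} :=
  [ffun r => f (elt r)].
rewrite [RHS](reindex_onto h h') /=; last first.
  move=> f fs; apply/ffunP=> i; rewrite !ffunE.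
  apply: (fixes_coloring_porbit fs).
  by rewrite -eq_porbit_mem eltP rkK.
rewrite [RHS](eq_bigl xpredT) => [|g]; last first.
  apply/andP; split.
    apply/forallP=> i; rewrite !ffunE (_ : rk (s i) = rk i) //.
    by apply/eqP; rewrite rk_eq rkK; have := mem_porbit s 1 i; rewrite expg1.
  apply/eqP/ffunP=> r; rewrite !ffunE; congr (g _).
  by apply/eqP; rewrite rk_eq -eltP porbit_id.
apply: eq_bigr => g _.
rewrite [RHS](partition_big rk xpredT) //=; apply: eq_bigr => r _.
rewrite (eq_bigr (fun=> x (g r))) => [|i /eqP <-]; last by rewrite ffunE.
rewrite prodr_const; congr (_ ^+ _); apply: eq_card => i.
by rewrite -rk_eq.
Qed.

End FixedColorings.

(** The colour of the fixed point [i] is free, and the rest is a colouring fixed by [s]. *)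
Lemma sum_fixes_lift_perm (n : nat) (C : finType) (R : comPzRingType) (x : C -> R)
    (i : 'I_n.+1) (s : 'S_n) :
  \sum_(f : {ffun 'I_n.+1 -> C} | fixes_coloring (lift_perm i i s) f) \prod_j x (f j)
  = (\sum_c x c) * \sum_(f : {ffun 'I_n -> C} | fixes_coloring s f) \prod_j x (f j).
Proof.
rewrite big_distrlr /= pair_big /=.
pose h (cf : C * {ffun 'I_n -> C}) : {ffun 'I_n.+1 -> C} :=
  [ffun j => if unlift i j is Some j' then cf.2 j' else cf.1].
pose h' (f : {ffun 'I_n.+1 -> C}) := (f i, [ffun j => f (lift i j)] : {ffun 'I_n -> C}).
have hK : cancel h h'.
  move=> [c f]; rewrite /h' ffunE unlift_none; congr (_, _).
  by apply/ffunP=> j; rewrite !ffunE liftK.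
have h'K : cancel h' h.
  move=> f; apply/ffunP=> j; rewrite ffunE.
  by case: unliftP => [j'|] ->; rewrite ?ffunE.
rewrite (reindex h) /=; last by exists h' => ? _.
apply: eq_big => [[c f]|[c f] _] /=.
  apply/forallP/forallP=> fs j.
    by have := fs (lift i j); rewrite lift_perm_lift !ffunE !liftK.
  case: (unliftP i j) => [j'|] ->.
    by rewrite lift_perm_lift !ffunE !liftK fs.
  by rewrite lift_perm_id.
rewrite (bigD1_ord i) //= ffunE unlift_none; congr (_ * _).
by apply: eq_bigr => j _; rewrite ffunE liftK.
Qed.

Definition nfix (n : nat) (s : 'S_n) : nat := #|[set i | s i == i]|.

Lemma nfix_lift_perm (n : nat) (i : 'I_n.+1) (s : 'S_n) :
  nfix (lift_perm i i s) = (nfix s).+1.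
Proof.
rewrite /nfix -!sum1dep_card (bigD1_ord i) /=; last by rewrite lift_perm_id.
rewrite add1n; congr _.+1; apply: eq_bigl => j.
by rewrite lift_perm_lift (inj_eq lift_inj).
Qed.

Lemma sum_fixing_lift_perm (n : nat) (V : nmodType) (i : 'I_n.+1) (G : 'S_n.+1 -> V) :
  \sum_(s : 'S_n.+1 | s i == i) G s = \sum_(s : 'S_n) G (lift_perm i i s).
Proof.
have ex_lift (s : 'S_n.+1) j : s i == i -> exists a, s (lift i j) = lift i a.
  move=> /eqP si; case: (unliftP i (s (lift i j))) => [a ea|]; first by exists a.
  move=> e; have e' : lift i j = i by apply: (@perm_inj _ s); rewrite si.
  by have := neq_lift i j; rewrite e' eqxx.
have inj (s : 'S_n.+1) : s i == i -> injective (fun j => odflt j (unlift i (s (lift i j)))).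
  move=> si j j'; have [a ea] := ex_lift s j si; have [b eb] := ex_lift s j' si.
  rewrite ea eb !liftK /= => eab; apply: (@lift_inj _ i).
  by apply: (@perm_inj _ s); rewrite ea eb eab.
(* The inverse of [lift_perm i i]; permutations moving [i] get the dummy value 1. *)
pose h' (s : 'S_n.+1) := if boolP (s i == i) is AltTrue e then perm (inj s e) else 1%g.
rewrite (reindex_onto (lift_perm i i) h') /=; last first.
  move=> s si; rewrite /h'; case: {-}_ / boolP => [e|]; last by rewrite si.
  apply/permP=> j; case: (unliftP i j) => [j'|] ->; last by rewrite lift_perm_id (eqP si).
  by rewrite lift_perm_lift permE; have [a ->] := ex_lift s j' si; rewrite liftK.
apply: eq_bigl => s; rewrite lift_perm_id eqxx /h'.
case: {-}_ / boolP => [e|]; last by rewrite lift_perm_id eqxx.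
by apply/eqP/permP=> j; rewrite permE lift_perm_lift liftK.
Qed.

(** * Monomials as contents of words *)

Section Contents.

Variables (F : numFieldType) (N : nat).
Implicit Types (t : seq 'I_N) (u : 'X_{1..N}).

Definition content t : 'X_{1..N} := [multinom count_mem c t | c < N].

Lemma prod_X_content t : \prod_(c <- t) 'X_c = 'X_[content t] :> {mpoly F[N]}.
Proof.
elim: t => [|c t IH].
  rewrite big_nil -mpolyX0; congr ('X_[_]); apply/mnmP=> c; by rewrite mnm0E mnmE.
rewrite big_cons IH -mpolyXD; congr ('X_[_]).
by apply/mnmP=> d; rewrite mnmDE mnm1E !mnmE.
Qed.

Lemma mdeg_content t : mdeg (content t) = size t.
Proof.
rewrite mdegE; under eq_bigr do rewrite mnmE.
elim: t => [|c t IH] /=; first by rewrite big1.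
by rewrite big_split IH /= (bigD1 c) //= eqxx big1 // => d /negPf; rewrite eq_sym => ->.
Qed.

Lemma content_perm t1 t2 : content t1 = content t2 -> perm_eq t1 t2.
Proof.
move=> e; apply/allP=> c _; apply/eqP.
by have := congr1 (fun u : 'X_{1..N} => u c) e; rewrite !mnmE.
Qed.

Definition sorted_word t := sorted leq [seq nat_of_ord c | c <- t].

Lemma sorted_content_inj t1 t2 :
  sorted_word t1 -> sorted_word t2 -> content t1 = content t2 -> t1 = t2.
Proof.
move=> s1 s2 /content_perm p12; apply: (inj_map val_inj).
by apply: (sorted_eq leq_trans anti_leq) => //; apply: perm_map.
Qed.

Lemma content_onto u : exists2 t, sorted_word t & content t = u.
Proof.
pose t := flatten [seq nseq (u c) c | c <- index_enum 'I_N].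
have ct : content t = u.
  apply/mnmP=> c; rewrite mnmE count_flatten sumnE !big_map.
  rewrite (bigD1 c) //= count_nseq /= eqxx mul1n big1 ?addn0 // => d ne.
  by rewrite count_nseq /= (negPf ne) mul0n.
pose r := sort (relpre (@nat_of_ord N) leq) t.
exists r.
  rewrite /sorted_word sorted_map; apply: sort_sorted => a b; exact: leq_total.
rewrite -ct; apply/mnmP=> c; rewrite !mnmE; exact/seq.permP/permEl/perm_sort.
Qed.

(** Every monomial of degree [m] is the content of exactly one weakly increasing word. *)
Lemma hsym_sorted m :
  hsym F N m = \sum_(t : m.-tuple 'I_N | sorted_word t) \prod_(c <- t) 'X_c.
Proof.
have lt_m (t : m.-tuple 'I_N) : (mdeg (content t) < m.+1)%N.
  by rewrite mdeg_content size_tuple.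
rewrite (partition_big (fun t : m.-tuple 'I_N => BMultinom (lt_m t))
  (fun u : 'X_{1..N < m.+1} => mdeg u == m)) /=; last first.
  by move=> t _; rewrite mdeg_content size_tuple.
apply: eq_bigr => u /eqP um.
have [t st ct] := content_onto u.
have szt : size t = m by rewrite -mdeg_content ct.
rewrite (big_pred1 (tcast szt (in_tuple t))).
  by rewrite /= (val_tcast szt (in_tuple t)) prod_X_content ct.
move=> r /=; rewrite -val_eqE /=; apply/andP/eqP => [[sr /eqP cr]|->].
  apply: val_inj; rewrite /= (val_tcast szt (in_tuple t)) /=.
  by apply: sorted_content_inj sr st _; rewrite ct.
by rewrite (val_tcast szt (in_tuple t)) /= st ct.
Qed.

End Contents.

(** * Counting colourings fixed by permutations *)

Section Burnside.

Variables (F : numFieldType) (N n : nat).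

Definition perm_coloring (f : {ffun 'I_n -> 'I_N}) (s : 'S_n) : {ffun 'I_n -> 'I_N} :=
  [ffun i => f (s^-1%g i)].

Lemma perm_coloring_is_action : is_action [set: 'S_n] perm_coloring.
Proof.
apply: is_total_action => [f|f s t]; apply/ffunP=> i; rewrite !ffunE.
  by rewrite invg1 perm1.
by rewrite invMg permM.
Qed.

Definition perm_coloring_action := Action perm_coloring_is_action.

Lemma fixes_coloringE s f : fixes_coloring s f = (perm_coloring f s == f).
Proof.
apply/forallP/eqP => [fs|e i].
  by apply/ffunP=> i; rewrite ffunE -{2}(permKV s i) (eqP (fs _)).
by rewrite -{1}e ffunE permK.
Qed.

Let word (f : {ffun 'I_n -> 'I_N}) : n.-tuple 'I_N := [tuple f i | i < n].

Lemma content_perm_coloring f s : content (word (perm_coloring f s)) = content (word f).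
Proof.
apply/mnmP=> c; rewrite !mnmE; apply/seq.permP.
rewrite perm_sym; apply/tuple_permP; exists s.
by apply/eq_map => i /=; rewrite tnth_mktuple ffunE permK.
Qed.

Lemma same_content_coloring f g : content (word f) = content (word g) ->
  exists s, perm_coloring f s = g.
Proof.
move/content_perm; rewrite perm_sym => /tuple_permP[p e]; exists p^-1%g.
apply/ffunP=> i; rewrite ffunE invgK.
have := congr1 (fun t : n.-tuple 'I_N => tnth t i) (val_inj e : word g = _).
by rewrite !tnth_mktuple.
Qed.

Lemma coloring_content_onto (u : 'X_{1..N}) : mdeg u = n -> exists f, content (word f) = u.
Proof.
have [t _ <-] := content_onto u; rewrite mdeg_content => szt.
exists [ffun i => tnth (tcast szt (in_tuple t)) i]; congr content.
rewrite -[RHS]/(tval (in_tuple t)) -(val_tcast szt (in_tuple t)); congr tval.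
by apply: eq_from_tnth => i; rewrite tnth_mktuple ffunE.
Qed.

(** The colourings with content [u] form a single orbit, so the Cauchy-Frobenius count equals the
    order of the group. *)
Lemma sum_fixed_colorings_content (u : 'X_{1..N}) : mdeg u = n ->
  (\sum_(s : 'S_n) #|[set f | fixes_coloring s f & content (word f) == u]| = n`!)%N.
Proof.
move=> un; pose S := [set f | content (word f) == u].
have actS : [acts [set: 'S_n], on S | perm_coloring_action].
  by apply/actsP=> s _ f; rewrite !inE content_perm_coloring.
have := Frobenius_Cauchy actS.
have -> : [set orbit perm_coloring_action [set: 'S_n] f | f in S] = [set S].
  have [f0 f0u] := coloring_content_onto un.
  have orbS f : f \in S -> orbit perm_coloring_action [set: 'S_n] f = S.
    rewrite inE => /eqP fu; apply/setP=> g; rewrite [in RHS]inE.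
    apply/orbitP/eqP => [[s _ <-]|gu]; first by rewrite content_perm_coloring.
    have [|s <-] := @same_content_coloring f g; first by rewrite fu gu.
    by exists s; rewrite ?inE.
  apply/setP=> A; rewrite !inE; apply/imsetP/eqP => [[f fS ->]|->]; first exact: orbS.
  by exists f0; rewrite ?orbS ?inE ?f0u.
rewrite cards1 mul1n cardsT card_Sn => <-.
apply: eq_big => [s|s _]; first by rewrite inE.
by apply: eq_card => f; rewrite !inE fixes_coloringE sub1set inE andbC.
Qed.

Lemma sum_fixed_colorings :
  \sum_(s : 'S_n) \sum_(f : {ffun 'I_n -> 'I_N} | fixes_coloring s f) \prod_i 'X_(f i)
    = n`!%:R *: hsym F N n.
Proof.
have word_lt f : (mdeg (content (word f)) < n.+1)%N by rewrite mdeg_content size_tuple.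
have prodE (f : {ffun 'I_n -> 'I_N}) : \prod_i 'X_(f i) = 'X_[content (word f)] :> {mpoly F[N]}.
  by rewrite -prod_X_content big_map big_enum.
under eq_bigr => s _.
  rewrite (partition_big (fun f => BMultinom (word_lt f)) (fun u => mdeg u == n)) /=; last first.
    by move=> f _; rewrite mdeg_content size_tuple card_ord.
  over.
rewrite exchange_big /= /hsym scaler_sumr; apply: eq_bigr => u /eqP un.
rewrite -(sum_fixed_colorings_content un) natr_sum scaler_suml; apply: eq_bigr => s _.
rewrite scaler_nat -sumr_const; apply: eq_big => [f|f /andP[_ /eqP <-]]; last exact: prodE.
by rewrite inE -val_eqE.
Qed.

End Burnside.

Section PermSums.

Variables (F : numFieldType) (N : nat).

Definition pcycle (n : nat) (s : 'S_n) : {mpoly F[N]} :=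
  \prod_(O in porbits s) psym F N #|O|.

Lemma pcycleE n (s : 'S_n) :
  pcycle s = \sum_(f : {ffun 'I_n -> 'I_N} | fixes_coloring s f) \prod_i 'X_(f i).
Proof. exact: prod_porbits_coloring. Qed.

Lemma hsym1 : hsym F N 1 = \sum_c 'X_c.
Proof.
rewrite hsym_sorted (reindex (fun c : 'I_N => [tuple c])) /=.
  by apply: eq_big => [c|c _] //; rewrite big_seq1.
exists (fun t : 1.-tuple 'I_N => thead t) => [c _|t _]; first exact: theadE.
by apply: val_inj; case/tupleP: t => c t; rewrite theadE /= tuple0.
Qed.

Lemma hsym0 : hsym F N 0 = 1.
Proof.
rewrite hsym_sorted (big_pred1 [tuple]) => [|t]; first by rewrite big_nil.
rewrite [t]tuple0; symmetry; exact/eqP.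
Qed.

Lemma pcycle_lift_perm n (i : 'I_n.+1) s : pcycle (lift_perm i i s) = hsym F N 1 * pcycle s.
Proof. by rewrite !pcycleE hsym1; exact: (sum_fixes_lift_perm (fun c => 'X_c)). Qed.

(** Induction through [x ^_ d.+1 = x * x.-1 ^_ d]: the factor [x] counts a chosen fixed point, whose
    stabilizer is the symmetric group on the other points, and the fixed point contributes a factor
    h_1. *)
Lemma sum_ffact_pcycle n d : (d <= n)%N ->
  \sum_(s : 'S_n) (nfix s ^_ d)%:R *: pcycle s
    = n`!%:R *: (hsym F N 1 ^+ d * hsym F N (n - d)).
Proof.
elim: d n => [|d IH] n dn.
  rewrite subn0 mul1r -sum_fixed_colorings; apply: eq_bigr => s _.
  by rewrite ffactn0 scale1r pcycleE.
case: n dn => // n dn.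
transitivity (\sum_(i < n.+1) \sum_(s : 'S_n.+1 | s i == i)
    ((nfix s).-1 ^_ d)%:R *: pcycle s).
  under [RHS]eq_bigr do rewrite big_mkcond.
  rewrite exchange_big /=; apply: eq_bigr => s _.
  rewrite -big_mkcond /= sumr_const ffactnS natrM -scalerA scaler_nat.
  by congr (_ *+ _); apply: eq_card => i; rewrite inE.
under eq_bigr => i _.
  rewrite sum_fixing_lift_perm.
  under eq_bigr do rewrite nfix_lift_perm /= pcycle_lift_perm scalerAr.
  rewrite -mulr_sumr IH //; over.
rewrite sumr_const card_ord subSS exprS -scaler_nat factS natrM -scalerA -scalerAr.
by rewrite mulrA.
Qed.

End PermSums.

(** * Traces and Frobenius characteristics *)

Section Traces.

Variables (F : numFieldType).

Lemma mxtrace_natural n (s : 'S_n) : \tr (perm_mx s : 'M[F]_n) = (nfix s)%:R.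
Proof.
rewrite /mxtrace /nfix -sum1dep_card natr_sum [RHS]big_mkcond; apply: eq_bigr => i _.
by rewrite !mxE; case: eqP.
Qed.

(** The natural trace counts fixed points, and the quotient by the sum-zero vectors is
    one-dimensional with trivial action. *)
Lemma mxtrace_reflection n (s : 'S_n) : (0 < n)%N ->
  \tr (reflection F n s) = (nfix s)%:R - 1.
Proof.
move=> n0; set K := kermx (const_mx 1 : 'cV[F]_n).
apply/eqP; rewrite eq_sym subr_eq; apply/eqP.
rewrite -mxtrace_natural -(mxtrace_sub_fact_mod (sum_zero_module F n) s).
congr (_ + _).
have rk1 : \rank (const_mx 1 : 'cV[F]_n) = 1%N.
  apply/eqP; rewrite eqn_leq rank_leq_col lt0n mxrank_eq0.
  by apply/eqP=> /matrixP/(_ (Ordinal n0) 0); rewrite !mxE; apply/eqP; rewrite oner_eq0.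
have rkK : \rank (cokermx K) = 1%N.
  by rewrite mxrank_coker mxrank_ker rk1 subKn.
have -> : factmod_repr (sum_zero_module F n) s = 1%:M.
  rewrite /= /factmod_mx -[RHS]val_factmodK; apply/eqP; rewrite -subr_eq0 -linearB /=.
  rewrite in_factmod_eq0; apply/sub_kermxP.
  rewrite mulmxBl -mulmxA (_ : perm_mx s *m const_mx 1 = const_mx 1) ?subrr //.
  by rewrite -row_permE; apply/matrixP=> i j; rewrite !mxE.
by rewrite mxtrace1 rkK.
Qed.

Lemma mxtrace_tensor_pow n (V : Smodule F n) k (s : 'S_n) :
  \tr (tensor_pow V k.+1 s) = (\tr (V s)) ^+ k.+1.
Proof.
rewrite /tensor_pow iteropS; elim: k => [|k IH]; first by rewrite expr1.
by rewrite exprS -IH [LHS]mxtrace_prod.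
Qed.

Lemma chE N n (V : Smodule F n) :
  ch N V = n`!%:R^-1 *: \sum_(s : 'S_n) \tr (V s) *: pcycle F N s.
Proof. by []. Qed.

(** The predicate [P] allows both the full range of [d] and the range [d >= 2] needed for
    U_{n,k}. *)
Lemma sum_pcycle_ffact N n (phi : 'S_n -> F) (a : nat -> F) (P : pred nat) :
    (forall s, phi s = \sum_(0 <= d < n.+1 | P d) a d * (nfix s ^_ d)%:R) ->
  n`!%:R^-1 *: \sum_(s : 'S_n) phi s *: pcycle F N s
    = \sum_(0 <= d < n.+1 | P d) a d *: (hsym F N 1 ^+ d * hsym F N (n - d)).
Proof.
move=> phiE; under eq_bigr => s _ do rewrite phiE scaler_suml.
rewrite exchange_big scaler_sumr [LHS]big_nat_cond [RHS]big_nat_cond; apply: eq_bigr => d /andP[/andP[_ dn] _].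
under eq_bigr do rewrite -scalerA.
rewrite -scaler_sumr sum_ffact_pcycle // !scalerA mulrAC mulVf ?mul1r //.
by rewrite pnatr_eq0 -lt0n fact_gt0.
Qed.

Lemma ch_ffact N n (V : Smodule F n) (a : nat -> F) :
    (forall s : 'S_n, \tr (V s) = \sum_(0 <= d < n.+1) a d * (nfix s ^_ d)%:R) ->
  ch N V = \sum_(0 <= d < n.+1) a d *: (hsym F N 1 ^+ d * hsym F N (n - d)).
Proof. by move=> trV; rewrite chE (sum_pcycle_ffact _ trV). Qed.

Lemma nfix_le n (s : 'S_n) : (nfix s <= n)%N.
Proof. by rewrite /nfix -[X in (_ <= X)%N]card_ord max_card. Qed.

Lemma ch_reflection N n : (1 < n)%N ->
  ch N (reflection F n) = hsym F N 1 * hsym F N n.-1 - hsym F N n.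
Proof.
case: n => [|[|n]] // _.
(* The coefficients of x - 1 on the falling factorials: -1 at [d = 0], 1 at [d = 1], and 0
   beyond. *)
rewrite (@ch_ffact _ _ _ (fun d => if d is d'.+1 then (d' == 0%N)%:R else -1)).
  rewrite 2?big_ltn // big_nat_cond big1 => [|[|[|d]] //= _].
    by rewrite addr0 scaleN1r scale1r subn0 mul1r expr1 subn1 addrC.
  by rewrite scale0r.
move=> s; rewrite mxtrace_reflection // 2?big_ltn //.
rewrite big_nat_cond big1 => [|[|[|d]] //= _]; last by rewrite mul0r.
by rewrite ffactn0 ffactn1 mulr1 mul1r addr0 addrC.
Qed.

End Traces.

(* h_1 h_(n-1) is the sum over a row of length n - 1 and one more entry b; if b is at
   most the head of the row, b can be put in front of it. *)
Section SchurHook.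

Variables (F : numFieldType) (N m : nat).
Let l := [:: m.+1; 1%N].

Lemma hook_cell0 (j : 'I_m.+1) : (j < nth 0 l (@ord0 1))%N. Proof. exact: ltn_ord. Qed.
Lemma hook_cell1 : ((@ord0 m) < nth 0 l (lift ord0 (@ord0 0)))%N. Proof. by []. Qed.

Let row0 (j : 'I_m.+1) : cell l :=
  exist (fun c : 'I_2 * 'I_m.+1 => (c.2 < nth 0 l c.1)%N) (ord0, j) (hook_cell0 j).
Let row1 : cell l :=
  exist (fun c : 'I_2 * 'I_m.+1 => (c.2 < nth 0 l c.1)%N) (lift ord0 ord0, ord0) hook_cell1.

Lemma hook_cellP (c : cell l) : c = row1 \/ exists j, c = row0 j.
Proof.
case: c => [[i j] ij]; case: (unliftP ord0 i) => [i' ei|ei].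
  left; apply: val_inj; move: ij; rewrite /= ei (ord1 i') /= => j0.
  by congr (_, _); apply: val_inj => /=; case: (nat_of_ord j) j0.
by right; exists j; apply: val_inj; rewrite /= ei.
Qed.

Lemma prod_hook_cell (x : cell l -> {mpoly F[N]}) :
  \prod_c x c = x row1 * \prod_j x (row0 j).
Proof.
rewrite (bigD1 row1) //=; congr (_ * _).
rewrite (reindex_onto row0 (fun c => (val c).2)) /=; last first.
  by move=> c ne; case: (hook_cellP c) ne => [->|[j ->]]; rewrite ?eqxx.
by apply: eq_bigl => j; rewrite eqxx.
Qed.

Lemma sorted_tnth (t : m.+1.-tuple 'I_N) :
  reflect (forall i j : 'I_m.+1, (i <= j)%N -> (tnth t i <= tnth t j)%N) (sorted_word t).
Proof.
rewrite /sorted_word sorted_map.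
have tr : transitive (relpre (@nat_of_ord N) leq) by move=> a b c; apply: leq_trans.
have rf : reflexive (relpre (@nat_of_ord N) leq) by move=> a /=.
move: (tnth t ord0) => x0.
apply: (iffP idP) => [st i j ij|mono].
  rewrite !(tnth_nth x0).
  by apply: (sorted_leq_nth tr rf _ st); rewrite ?inE ?size_tuple.
apply/(sortedP x0) => i; rewrite size_tuple => im.
have := mono (Ordinal (ltnW im)) (Ordinal im) (leqnSn _).
by rewrite !(tnth_nth x0).
Qed.

Lemma schur_hook : schur F N l = hsym F N 1 * hsym F N m.+1 - hsym F N m.+2.
Proof.
pose h (bt : 'I_N * m.+1.-tuple 'I_N) : {ffun cell l -> 'I_N} :=
  [ffun c => if (val c).1 == ord0 then tnth bt.2 (val c).2 else bt.1].
pose h' (T : {ffun cell l -> 'I_N}) := (T row1, [tuple T (row0 j) | j < m.+1]).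
have hK : cancel h h'.
  move=> [b t]; rewrite /h' ffunE /=; congr (_, _).
  by apply: eq_from_tnth => j; rewrite tnth_mktuple ffunE.
have h'K : cancel h' h.
  move=> T; apply/ffunP=> c; rewrite ffunE.
  by case: (hook_cellP c) => [->|[j ->]] //=; rewrite tnth_mktuple.
have ssh b t : semistandard (h (b, t)) = sorted_word t && (thead t < b)%N.
  apply/forallP/andP => [ss|[/sorted_tnth st tb] c].
    split.
      apply/sorted_tnth => i j ij; have /forallP/(_ (row0 j))/andP[+ _] := ss (row0 i).
      by rewrite !ffunE /= ij.
    by have /forallP/(_ row1)/andP[_] := ss (row0 ord0); rewrite !ffunE.
  apply/forallP=> d; rewrite !ffunE.
  case: (hook_cellP c) => [->|[i ->]]; case: (hook_cellP d) => [->|[j ->]] //=.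
  - by rewrite leqnn.
  - by rewrite ltn0 andbF.
  - by rewrite andbT; apply/implyP=> /eqP ->.
  - apply/andP; split; first by apply/implyP=> /st.
    by rewrite ltnn andbF.
rewrite /schur (reindex h) /=; last by exists h' => ? _.
apply/eqP; rewrite eq_sym subr_eq; apply/eqP.
rewrite hsym1 (hsym_sorted F N m.+1) big_distrlr /=.
under eq_bigr => b _.
  rewrite (bigID (fun t : m.+1.-tuple 'I_N => (thead t < b)%N)) /=; over.
rewrite big_split /=; congr (_ + _).
  rewrite pair_big_dep /=; apply: eq_big => [[b t]|[b t] _]; first by rewrite ssh.
  rewrite prod_hook_cell ffunE /=; congr (_ * _).
  by rewrite big_tuple; apply: eq_bigr => j _; rewrite ffunE.
rewrite pair_big_dep /= hsym_sorted.
rewrite [RHS](reindex (fun bt : 'I_N * m.+1.-tuple 'I_N => [tuple of bt.1 :: bt.2])) /=.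
  apply: eq_big => [[b t]|[b t] _] /=; last by rewrite big_cons.
  rewrite /sorted_word /= -leqNgt; case/tupleP: t => a t /=.
  by rewrite theadE andbC.
exists (fun t : m.+2.-tuple 'I_N => (thead t, [tuple of behead t])).
  by move=> [b t] _; congr (_, _); apply: val_inj.
by move=> t _; apply: val_inj => /=; case/tupleP: t => a t; rewrite theadE.
Qed.

End SchurHook.

(** * Power sums and the internal product *)

Section PowerSums.

Variables (F : numFieldType) (N : nat).

(** The exponent of the monomial obtained from p_l by choosing the variable [f j] in the j-th
    factor. *)
Definition psymp_exponent (l : seq nat) (f : {ffun 'I_(size l) -> 'I_N}) : 'X_{1..N} :=
  [multinom \sum_(j | f j == i) nth 0 l j | i < N]%N.

Lemma psympE l : psymp F N l = \sum_(f : {ffun 'I_(size l) -> 'I_N}) 'X_[psymp_exponent f].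
Proof.
rewrite /psymp (big_nth 0) big_mkord /psym bigA_distr_bigA /=.
apply: eq_bigr => f _; rewrite mpolyXE_id.
rewrite (partition_big f xpredT) //=; apply: eq_bigr => i _.
rewrite mnmE -prodrXr; apply: eq_bigr => j /eqP <-.
by [].
Qed.

Definition part_monomial (l : seq nat) : 'X_{1..N} := [multinom nth 0 l i | i < N]%N.

Lemma count_mem_card (s : seq nat) v :
  count_mem v s = #|[set j : 'I_(size s) | nth 0 s j == v]|%N.
Proof. by rewrite -sum1_count (big_nth 0) big_mkord sum1dep_card. Qed.

(** Each of the first [size l] variables occurs in the monomial, so [f] hits all of them; since [m]
    has at most as many parts, [f] is a bijection onto them and the parts agree. *)
Lemma psymp_exponent_part l m (f : {ffun 'I_(size m) -> 'I_N}) :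
    all (leq 1) l -> all (leq 1) m -> (size l <= N)%N -> (size m <= size l)%N ->
    psymp_exponent f = part_monomial l -> perm_eq m l.
Proof.
move=> l1 m1 lN ml e.
have eE i : (\sum_(j | f j == i) nth 0 m j = nth 0 l i)%N.
  by have := congr1 (fun u : 'X_{1..N} => u i) e; rewrite !mnmE.
have pos_l i : (i < size l)%N -> (0 < nth 0 l i)%N by move=> il; apply: (all_nthP 0 l1).
have winj : injective (widen_ord lN).
  by move=> x y /(congr1 val) /= xy; apply: val_inj.
pose A := [set i : 'I_N | (i < size l)%N].
have cardA : #|A| = size l.
  rewrite -[RHS]card_ord -(card_imset _ winj).
  apply: eq_card => i; rewrite inE; apply/idP/imsetP => [il|[j _ ->]]; last exact: (ltn_ord j).
  by exists (Ordinal il) => //; apply: val_inj.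
have subA : A \subset f @: [set: 'I_(size m)].
  apply/subsetP=> i; rewrite inE => /pos_l; rewrite -eE.
  have [j /eqP fj _|nof] := pickP (fun j => f j == i).
    by apply/imsetP; exists j.
  by rewrite big_pred0.
have f_inj : injective f.
  suff /imset_injP inj : #|f @: [set: 'I_(size m)]| == #|[set: 'I_(size m)]|.
    by move=> x y; apply: inj; rewrite inE.
  rewrite eqn_leq leq_imset_card cardsT card_ord (leq_trans ml) // -cardA.
  exact: subset_leq_card.
apply/allP=> v _; apply/eqP.
have [->|v0] := eqVneq v 0%N.
  have no0 s : all (leq 1) s -> count_mem 0%N s = 0%N.
    by move=> s1; apply/count_memPn; apply/negP=> /(allP s1).
  by rewrite !no0.
rewrite !count_mem_card.
have eEf j : nth 0 l (f j) = nth 0 m j.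
  by rewrite -eE (eq_bigl (pred1 j)) ?big_pred1_eq // => j'; rewrite (inj_eq f_inj).
pose B := [set i : 'I_N | nth 0 l i == v].
have eB1 : #|B| = #|[set j : 'I_(size m) | nth 0 m j == v]|%N.
  rewrite -(card_imset _ f_inj); apply: eq_card => i; rewrite inE.
  apply/eqP/imsetP => [iv|[j + ->]]; last by rewrite inE => /eqP <-; rewrite eEf.
  have : i \in A by rewrite inE ltnNge; apply: contra v0 => /(nth_default 0); rewrite iv => ->.
  by move/(subsetP subA)/imsetP=> [j _ ej]; exists j; rewrite // inE -eEf -ej iv.
rewrite -eB1 -(card_imset _ winj).
apply: eq_card => i; rewrite inE; apply/eqP/imsetP => [iv|[j + ->]].
  have il : (i < size l)%N.
    by rewrite ltnNge; apply: contra v0 => /(nth_default 0); rewrite iv => ->.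
  by exists (Ordinal il); rewrite ?inE ?iv //; apply: val_inj.
by rewrite inE => /eqP.
Qed.

Lemma parts_is_part n (l : intpart n) : is_part n (parts l).
Proof. exact: (valP l). Qed.

Lemma parts_inj n : injective (@parts n).
Proof. by move=> l m /(inj_map val_inj) e; apply: val_inj; apply: val_inj. Qed.

Lemma is_part_size n s : is_part n s -> (size s <= n)%N.
Proof.
case/and3P=> _ + /eqP <-; elim: s => //= a s IH /andP[a1 /IH ss].
by rewrite -add1n leq_add.
Qed.

(* Triangularity: the monomial of exponent l occurs in p_m only if m refines l, so a
   longest l with a nonzero coefficient gives a contradiction. *)
Lemma psymp_free n (a : intpart n -> F) : (n <= N)%N ->
  \sum_l a l *: psymp F N (parts l) = 0 -> forall l, a l = 0.
Proof.
move=> nN a0 l; apply/eqP/idPn => al.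
have [m am max_m] := arg_maxnP (P := fun l => a l != 0) (fun l : intpart n => size (parts l)) al.
have /and3P[srt_m m1 _] := parts_is_part m.
have mN : (size (parts m) <= N)%N.
  by rewrite (leq_trans _ nN) // is_part_size // parts_is_part.
have := congr1 (mcoeff (part_monomial (parts m))) a0.
rewrite linear_sum (bigD1 m) //= big1 ?addr0 => [/eqP|r rm].
  rewrite mcoeffZ mcoeff0 mulf_eq0 (negPf am) /= psympE linear_sum /=.
  under eq_bigr do rewrite mcoeffX.
  rewrite -natr_sum pnatr_eq0 sum_nat_eq0 => /forallP/(_ [ffun j => widen_ord mN j]).
  rewrite implyTb eqb0 => /negP[]; apply/eqP/mnmP=> i; rewrite !mnmE.
  have [im|mi] := ltnP i (size (parts m)); last first.
    rewrite nth_default // big1 // => j; rewrite ffunE => /eqP ej.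
    by move: mi; rewrite -ej leqNgt /= ltn_ord.
  rewrite (eq_bigl (pred1 (Ordinal im))) ?big_pred1_eq // => j.
  by rewrite ffunE -!val_eqE.
rewrite mcoeffZ; have [->|ar] := eqVneq (a r) 0; first by rewrite mul0r.
rewrite psympE linear_sum big1 ?mulr0 //= => f _; rewrite mcoeffX.
case: eqP => // ef; case/eqP: rm; apply: parts_inj.
have /and3P[srt_r r1 _] := parts_is_part r.
apply: (sorted_eq (leT := geq)) => //.
- by move=> x y z xy yz; apply: leq_trans yz xy.
- by move=> x y /andP[xy yx]; apply/eqP; rewrite eqn_leq; apply/andP; split.
- exact: psymp_exponent_part (max_m r ar) ef.
Qed.

Lemma pcoord_unique n (a : intpart n -> F) : (n <= N)%N ->
  forall l, pcoord n (\sum_l a l *: psymp F N (parts l)) l = a l.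
Proof.
move=> nN l; rewrite /pcoord; set P := fun b : {ffun _ -> F} => _.
have : P (ClassicalEpsilon.epsilon (inhabits 0) P).
  apply: ClassicalEpsilon.epsilon_spec; exists [ffun l => a l].
  by apply: eq_bigr => m _; rewrite ffunE.
rewrite {1}/P => e; apply/eqP; rewrite -subr_eq0; apply/eqP.
apply: (@psymp_free n (fun l => _ l - a l)) nN _ l.
by under eq_bigr do rewrite scalerBl; rewrite sumrB -e subrr.
Qed.

End PowerSums.

(** * Newton's identity for complete functions *)

Section Newton.

Variables (F : numFieldType) (N : nat).

Lemma mcoeff_hsym k (m : 'X_{1..N}) : (hsym F N k)@_m = (mdeg m == k)%:R.
Proof.
rewrite /hsym linear_sum /=; under eq_bigr do rewrite mcoeffX.
have [mk|mk] := eqVneq (mdeg m) k; last first.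
  rewrite big1 // => u /eqP uk; case: eqP => // um.
  by case/eqP: mk; rewrite -um.
have lt_m : (mdeg m < k.+1)%N by rewrite mk.
rewrite (bigD1 (BMultinom lt_m)) /= ?mk // eqxx big1 ?addr0 // => u /andP[_ ne].
by case: eqP => // um; case/eqP: ne; apply: val_inj.
Qed.

Lemma mcoeff_psym_hsym j k (m : 'X_{1..N}) :
  (psym F N j * hsym F N k)@_m = (#|[set i | j <= m i]%N| * (mdeg m == j + k))%N%:R.
Proof.
rewrite /psym mulr_suml linear_sum /= -sum1dep_card big_distrl natr_sum /= [RHS]big_mkcond.
apply: eq_bigr => i _; rewrite mul1n mpolyXn.
have [jm|mj] := leqP j (m i).
  have le_m : (U_(i) *+ j <= m)%MM.
    apply/mnm_lepP=> i'; rewrite mulmnE mnm1E; case: eqP => [<-|_] //.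
    by rewrite mul1n.
  have e : (U_(i) *+ j + (m - U_(i) *+ j))%MM = m by rewrite addmC submK.
  rewrite [X in X@__]mulrC -{1}e mcoeffMX mcoeff_hsym; congr (_%:R : F).
  have : mdeg m = (mdeg (m - U_(i) *+ j)%MM + j)%N.
    by rewrite -{1}e mdegD mdegMn mdeg1 mul1n addnC.
  by move=> ->; rewrite [(j + k)%N]addnC eqn_add2r.
rewrite mulrC /hsym mulr_suml linear_sum big1 //= => u _.
rewrite -mpolyXD mcoeffX; case: eqP => // e.
by move: mj; rewrite -e mnmDE mulmnE mnm1E eqxx mul1n ltnNge leq_addl.
Qed.

(** Coefficientwise: summing over [j] the number of variables with exponent at least [j] gives the
    degree. *)
Lemma newton_hsym n :
  n%:R *: hsym F N n = \sum_(1 <= j < n.+1) psym F N j * hsym F N (n - j).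
Proof.
apply/mpolyP=> m; rewrite mcoeffZ mcoeff_hsym linear_sum /=.
rewrite (eq_big_nat _ _ (F2 := fun j => (#|[set i | j <= m i]%N| * (mdeg m == n))%N%:R)); last first.
  by move=> j /andP[_ jn]; rewrite mcoeff_psym_hsym subnKC.
rewrite -natr_sum -natrM -big_distrl /=; congr (_%:R).
have [mn|] := eqVneq (mdeg m) n; last by rewrite !muln0.
rewrite !muln1; under eq_bigr do rewrite -sum1dep_card big_mkcond.
rewrite exchange_big /= -[LHS]mn mdegE; apply: eq_bigr => i _.
rewrite -big_mkcond /= big_add1 /= big_mkord.
have le_mi : (m i <= n)%N by rewrite -mn mdegE (bigD1 i) //= leq_addr.
rewrite sum1dep_card; symmetry; transitivity #|widen_ord le_mi @: [set: 'I_(m i)]|; last first.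
  by rewrite card_imset ?cardsT ?card_ord // => a b /(congr1 val) /= ab; apply: val_inj.
apply: eq_card => j; rewrite inE; apply/idP/imsetP => [jm|[j' _ ->]]; last exact: (ltn_ord j').
by exists (Ordinal jm); rewrite ?inE //; apply: val_inj.
Qed.

End Newton.

(** * Partitions and cycle types *)

Section CycleTypes.

(** Absent parts contribute a factor 1; a common range makes different partitions comparable. *)
Lemma zpart_range (l : seq nat) b : all (fun i => i < b)%N l ->
  zpart l = (\prod_(0 <= i < b) (i ^ count_mem i l * (count_mem i l)`!))%N.
Proof.
move=> lb; rewrite /zpart.
rewrite (perm_big [seq i <- index_iota 0 b | i \in l]) /=; last first.
  apply: uniq_perm; rewrite ?undup_uniq ?filter_uniq ?iota_uniq // => i.
  rewrite mem_undup mem_filter mem_index_iota /=; case: (boolP (i \in l)) => //= il.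
  by rewrite (allP lb).
rewrite big_filter big_mkcond; apply: eq_bigr => i _.
case: ifP => // /negbT/count_memPn ->.
by [].
Qed.

Lemma zpart_rem (l : seq nat) j : j \in l ->
  zpart l = (j * count_mem j l * zpart (rem j l))%N.
Proof.
move=> jl; pose b := (\max_(i <- l) i).+1.
have lb : all (fun i => i < b)%N l by apply/allP=> i il; rewrite ltnS leq_bigmax_seq.
have rb : all (fun i => i < b)%N (rem j l) by apply/allP=> i /mem_rem /(allP lb).
rewrite !(zpart_range (b := b)) //.
have jb : (j < b)%N by exact: (allP lb).
rewrite (bigD1_seq j) ?mem_index_iota ?iota_uniq //= [in RHS](bigD1_seq j) ?mem_index_iota ?iota_uniq //=.
rewrite mulnA; congr (_ * _)%N; last first.
  apply: eq_bigr => i ij.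
  by rewrite (seq.permP (perm_to_rem jl) (pred1 i)) /= eq_sym (negPf ij).
rewrite (seq.permP (perm_to_rem jl) (pred1 j)) /= eqxx add1n expnS factS.
by rewrite mulnACA.
Qed.

Definition part_list n : seq (seq nat) := [seq parts l | l : intpart n].

Lemma part_list_uniq n : uniq (part_list n).
Proof. by rewrite map_inj_uniq ?enum_uniq //; apply: parts_inj. Qed.

Lemma sumn_ge (s : seq nat) a : a \in s -> (a <= sumn s)%N.
Proof.
elim: s => //= b s IH; rewrite inE => /predU1P[->|/IH]; first exact: leq_addr.
by move/leq_trans; apply; apply: leq_addl.
Qed.

Lemma intpart_of n s : is_part n s -> exists l : intpart n, parts l = s.
Proof.
move=> ps; have sz := is_part_size ps; have /and3P[_ _ /eqP sn] := ps.
have szt : (size [seq (inord a : 'I_n.+1) | a <- s] <= n)%N by rewrite size_map.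
have et : [seq val a | a <- [seq (inord a : 'I_n.+1) | a <- s]] = s.
  rewrite -map_comp map_id_in // => a /sumn_ge; rewrite sn => an /=.
  by rewrite inordK.
have pt : is_part n [seq val a | a <- Bseq szt] by rewrite /= et.
by exists (exist _ (Bseq szt) pt).
Qed.

Lemma mem_part_list n s : (s \in part_list n) = is_part n s.
Proof.
apply/mapP/idP => [[l _ ->]|/intpart_of[l <-]]; first exact: parts_is_part.
by exists l; rewrite ?mem_enum.
Qed.

Lemma geq_sort_uniq s t : sorted geq s -> sorted geq t -> perm_eq s t -> s = t.
Proof.
apply: sorted_eq.
- by move=> x y z xy yz; apply: leq_trans yz xy.
- by move=> x y /andP[xy yx]; apply/eqP; rewrite eqn_leq; apply/andP; split.
Qed.

Lemma sort_geq_sorted s : sorted geq (sort geq s).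
Proof. by apply: sort_sorted => x y; apply: leq_total. Qed.

(** The inverse inserts [j] and sorts. This reorders the double sum over partitions and part sizes
    in [hsym_psym]. *)
Lemma rem_part_list n j : (0 < j <= n)%N ->
  perm_eq [seq rem j s | s <- part_list n & j \in s] (part_list (n - j)).
Proof.
case/andP=> j0 jn; apply: uniq_perm; rewrite ?part_list_uniq //.
  rewrite map_inj_in_uniq ?filter_uniq ?part_list_uniq // => s t.
  rewrite !mem_filter !mem_part_list => /andP[js /and3P[ss _ _]] /andP[jt /and3P[st _ _]] e.
  apply: geq_sort_uniq => //.
  by rewrite (perm_trans (perm_to_rem js)) // e perm_sym perm_to_rem.
move=> r; rewrite mem_part_list; apply/mapP/idP => [[s]|pr].
  rewrite mem_filter mem_part_list => /andP[js /and3P[ss s1 /eqP sn]] ->.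
  have := perm_sumn (perm_to_rem js); rewrite sn /= => nE.
  apply/and3P; split; last by rewrite nE addKn.
    apply: (subseq_sorted _ (rem_subseq j s) ss) => x y z xy yz; exact: leq_trans yz xy.
  by apply/allP=> i /mem_rem /(allP s1).
have /and3P[sr r1 /eqP rn] := pr.
have jm : j \in sort geq (j :: r) by rewrite mem_sort mem_head.
exists (sort geq (j :: r)).
  rewrite mem_filter jm mem_part_list andTb; apply/and3P; split.
  - exact: sort_geq_sorted.
  - by apply/allP=> i; rewrite mem_sort inE => /predU1P[->//|/(allP r1)].
  - by rewrite (perm_sumn (permEl (perm_sort _ _))) /= rn subnKC.
apply: geq_sort_uniq => //.
  apply: (subseq_sorted _ (rem_subseq _ _) (sort_geq_sorted _)) => x y z xy yz.
  exact: leq_trans yz xy.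
rewrite -(perm_cons j) perm_sym -(permPl (perm_to_rem jm)).
exact: permEl (perm_sort _ _).
Qed.

Lemma sumn_count (s : seq nat) b : all (fun a => 0 < a < b)%N s ->
  sumn s = (\sum_(1 <= j < b) j * count_mem j s)%N.
Proof.
elim: s => [|a s IH] /=; first by rewrite big1 // => j _; rewrite muln0.
case/andP=> ab /IH->; under [RHS]eq_bigr do rewrite mulnDr.
rewrite big_split /=; congr (_ + _)%N.
rewrite (bigD1_seq a) ?mem_index_iota ?iota_uniq //= eqxx muln1 big1 ?addn0 // => j.
by rewrite eq_sym => /negPf->; rewrite muln0.
Qed.

Lemma sum_porbits n (s : 'S_n) (G : {set 'I_n} -> nat) :
  (\sum_(B in porbits s) #|B| * G B = \sum_i G (porbit s i))%N.
Proof.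
rewrite [RHS](partition_big (porbit s) (mem (porbits s))) /=; last first.
  by move=> i _; apply: imset_f.
apply: eq_bigr => B /imsetP[j _ ->]; rewrite -sum_nat_const.
apply: eq_big => [i|i]; first by rewrite eq_porbit_mem.
by rewrite -eq_porbit_mem => /eqP ->.
Qed.

Definition orbit_sizes n (s : 'S_n) := sort geq [seq #|B| | B : {set 'I_n} in porbits s].

Lemma perm_orbit_sizes n (s : 'S_n) :
  perm_eq (orbit_sizes s) [seq #|B| | B : {set 'I_n} in porbits s].
Proof. exact: permEl (perm_sort _ _). Qed.

Lemma orbit_sizes_part n (s : 'S_n) : is_part n (orbit_sizes s).
Proof.
apply/and3P; split; first exact: sort_geq_sorted.
  apply/allP=> a; rewrite mem_sort => /mapP[B]; rewrite mem_enum => /imsetP[i _ ->] ->.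
  by apply/card_gt0P; exists i; apply: porbit_id.
rewrite (perm_sumn (perm_orbit_sizes s)) sumnE big_map big_enum /=.
under eq_bigr do rewrite -[#|_|]muln1.
by rewrite (sum_porbits s (fun=> 1%N)) sum_nat_const card_ord muln1.
Qed.

Lemma nfix_orbit_sizes n (s : 'S_n) : nfix s = count_mem 1%N (orbit_sizes s).
Proof.
rewrite (seq.permP (perm_orbit_sizes s)) count_map -sum1_count big_enum_cond /=.
rewrite /nfix -sum1dep_card big_mkcond [RHS]big_mkcondr /=.
transitivity (\sum_i (#|porbit s i| == 1%N))%N; last first.
  rewrite -(sum_porbits s (fun B => nat_of_bool (#|B| == 1%N))); apply: eq_bigr => B _.
  by case: eqP => [->|] //; rewrite muln0.
apply: eq_bigr => i _; have := porbit_id s i; case: eqP => [si iO|nsi iO].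
  rewrite (_ : porbit s i = [set i]) ?cards1 //.
  apply/setP=> j; rewrite inE; apply/porbitP/eqP => [[m ->]|->]; last by exists 0%N; rewrite expg0 perm1.
  by elim: m => [|m IH]; rewrite ?expg0 ?perm1 // expgSr permM IH.
case: eqP => // /eqP/cards1P[j eO]; case: nsi.
have := mem_porbit s 1 i; rewrite expg1 eO inE => /eqP->.
by move: iO; rewrite eO inE => /eqP.
Qed.

End CycleTypes.

Section ClassFunctions.

Variables (F : numFieldType) (N n : nat).
Hypothesis nN : (n <= N)%N.

Lemma pcycle_orbit_sizes (s : 'S_n) : pcycle F N s = psymp F N (orbit_sizes s).
Proof.
by rewrite /psymp (perm_big _ (perm_orbit_sizes s)) /= big_map big_enum.
Qed.

Lemma sum_part_list (V : nmodType) (G : seq nat -> V) :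
  \sum_(l : intpart n) G (parts l) = \sum_(l <- part_list n) G l.
Proof. by rewrite big_map big_enum. Qed.

Lemma zpart_gt0 l : all (leq 1) l -> (0 < zpart l)%N.
Proof.
move=> l1; rewrite /zpart big_seq prodn_cond_gt0 // => i; rewrite mem_undup => il.
by rewrite muln_gt0 expn_gt0 fact_gt0 (allP l1).
Qed.
End ClassFunctions.

(** Induction by Newton's identity: writing [n] as the sum of [j * count_mem j l], [zpart_rem] turns
    n / z_l into the sum, over the part sizes [j] of [l], of 1 / z for [l] with one [j] removed. *)
Lemma hsym_psym (F : numFieldType) (N n : nat) :
  hsym F N n = \sum_(l : intpart n) (zpart (parts l))%:R^-1 *: psymp F N (parts l).
Proof.
rewrite (sum_part_list n (fun l => (zpart l)%:R^-1 *: psymp F N l)).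
elim/ltn_ind: n => n IH.
have [->|n0] := posnP n.
  have -> : part_list 0 = [:: [::]].
    apply: perm_small_eq => //; apply: uniq_perm; rewrite ?part_list_uniq // => l.
    rewrite mem_part_list inE; apply/idP/eqP => [|->] // /is_part_size.
    by rewrite leqn0 => /nilP.
  by rewrite hsym0 big_seq1 /psymp /zpart !big_nil invr1 scale1r.
have nF : n%:R != 0 :> F by rewrite pnatr_eq0 -lt0n.
apply: (scalerI nF); rewrite newton_hsym scaler_sumr.
have terms l : l \in part_list n -> n%:R *: ((zpart l)%:R^-1 *: psymp F N l)
    = \sum_(1 <= j < n.+1 | j \in l)
        psym F N j * ((zpart (rem j l))%:R^-1 *: psymp F N (rem j l)).
  rewrite mem_part_list => pl; have /and3P[_ l1 /eqP ln] := pl.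
  have := @sumn_count l n.+1; rewrite ln => e.
  rewrite scalerA {1}e; last first.
    by apply/allP=> a al; rewrite (allP l1) //= ltnS -ln sumn_ge.
  rewrite natr_sum mulr_suml scaler_suml [RHS]big_mkcond /=.
  apply: eq_big_nat => j /andP[j0 _]; case: (boolP (j \in l)) => [jl|/count_memPn->]; last first.
    by rewrite muln0 mul0r scale0r.
  rewrite -scalerAr /psymp (perm_big _ (perm_to_rem jl)) big_cons; congr (_ *: _).
  rewrite (zpart_rem jl) (natrM _ (j * _)%N) invfM mulrA divff ?mul1r //.
  by rewrite pnatr_eq0 -lt0n muln_gt0 j0 -has_count has_pred1.
rewrite [RHS]big_seq; under [RHS]eq_bigr => l pl do rewrite (terms l pl) big_mkcond.
rewrite -big_seq exchange_big /=; apply: eq_big_nat => j /andP[j0 jn].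
rewrite IH; last by rewrite ltn_subrL j0.
rewrite -big_mkcond -big_filter -(perm_big _ (rem_part_list (j := j) (n := n) _)) ?j0 //=.
by rewrite big_map mulr_sumr.
Qed.

(** * Functions of the number of fixed points and their internal product *)

Section ClassFunctionSums.

Variables (F : numFieldType) (N n : nat).
Hypothesis nN : (n <= N)%N.

(** The Frobenius characteristic of the class function sending a permutation with x fixed points to
    [phi x], collected by cycle type. *)
Definition class_sum (phi : nat -> F) : {mpoly F[N]} :=
  \sum_(l : intpart n)
    (phi (count_mem 1%N (parts l)) / (zpart (parts l))%:R) *: psymp F N (parts l).

Lemma sum_orbit_sizes (V : nmodType) (G : 'S_n -> V) :
  \sum_s G s = \sum_(l : intpart n) \sum_(s | orbit_sizes s == parts l) G s.
Proof.
rewrite (exchange_big_dep xpredT) //=; apply: eq_bigr => s _.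
have [l el] := intpart_of (orbit_sizes_part s).
by rewrite (big_pred1 l) // => m; rewrite -el (inj_eq (@parts_inj n)) eq_sym.
Qed.

(* Compare the two expansions of h_n on power sums. *)
Lemma card_orbit_sizes (l : intpart n) :
  #|[set s : 'S_n | orbit_sizes s == parts l]|%:R / n`!%:R = (zpart (parts l))%:R^-1 :> F.
Proof.
pose A (m : intpart n) : F := #|[set s : 'S_n | orbit_sizes s == parts m]|%:R.
have nF : n`!%:R != 0 :> F by rewrite pnatr_eq0 -lt0n fact_gt0.
suff: \sum_m (A m / n`!%:R - (zpart (parts m))%:R^-1) *: psymp F N (parts m) = 0.
  by move/(psymp_free nN)/(_ l)/subr0_eq.
under eq_bigr do rewrite scalerBl.
rewrite sumrB -hsym_psym; apply/eqP; rewrite subr_eq0; apply/eqP.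
apply: (scalerI nF); rewrite -[RHS](@sum_fixed_colorings F N n).
rewrite [RHS](eq_bigr (pcycle F N (n := n))) => [|s _]; last by rewrite pcycleE.
rewrite [RHS]sum_orbit_sizes scaler_sumr; apply: eq_bigr => m _.
rewrite scalerA mulrC divfK // /A scaler_nat -sumr_const.
by apply: eq_big => [s|s]; rewrite inE // => /eqP e; rewrite pcycle_orbit_sizes e.
Qed.

Lemma ch_class_sum (V : Smodule F n) (phi : nat -> F) :
  (forall s : 'S_n, \tr (V s) = phi (nfix s)) -> ch N V = class_sum phi.
Proof.
move=> trV; rewrite chE sum_orbit_sizes scaler_sumr; apply: eq_bigr => l _.
rewrite (eq_bigr (fun=> phi (count_mem 1%N (parts l)) *: psymp F N (parts l))).
  rewrite -card_orbit_sizes sumr_const -scaler_nat !scalerA; congr (_ *: _).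
  rewrite (_ : #|_| = #|[set s : 'S_n | orbit_sizes s == parts l]|); first by ring.
  by apply: eq_card => s; rewrite inE.
by move=> s /eqP e; rewrite trV nfix_orbit_sizes pcycle_orbit_sizes e.
Qed.

Lemma kron_class_sum phi psi :
  kron n (class_sum phi) (class_sum psi) = class_sum (fun x => phi x * psi x).
Proof.
rewrite /kron; apply: eq_bigr => l _; rewrite !pcoord_unique //; congr (_ *: _).
have zF : (zpart (parts l))%:R != 0 :> F.
  by rewrite pnatr_eq0 -lt0n zpart_gt0 //; have /and3P[] := parts_is_part l.
by field.
Qed.

Lemma kron_pow_class_sum phi k :
  kron_pow n (class_sum phi) k.+1 = class_sum (fun x => phi x ^+ k.+1).
Proof.
rewrite /kron_pow iteropS; elim: k => [|k IH].
  by apply: eq_bigr => l _; rewrite expr1.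
by rewrite iterS IH kron_class_sum; apply: eq_bigr => l _; rewrite [in RHS]exprS.
Qed.

End ClassFunctionSums.

(** * A point that isolates the coefficient of h_1^n *)

Section Specialization.

Variables (F : numClosedFieldType).

(** X^n - 1 has n distinct roots in characteristic 0, and n distinct n-th roots of unity include a
    primitive one. *)
Lemma primitive_root_exists n : (0 < n)%N -> exists z : F, n.-primitive_root z.
Proof.
move=> n0; have nF : n%:R != 0 :> F by rewrite pnatr_eq0 -lt0n.
have [r er] := closed_field_poly_normal ('X^n - 1 : {poly F}).
have mon : ('X^n - 1 : {poly F}) \is monic by rewrite -polyC1 monicXnsubC.
rewrite (monicP mon) scale1r in er.
have rn : all n.-unity_root r.
  apply/allP=> z zr; rewrite unity_rootE -subr_eq0.
  have : root ('X^n - 1) z by rewrite er root_prod_XsubC.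
  by rewrite rootE !hornerE.
have sz : size r = n.
  by apply: succn_inj; rewrite -(size_prod_XsubC r idfun) -er -polyC1 size_XnsubC.
have ur : uniq r by rewrite -separable_prod_XsubC -er separable_Xn_sub_1.
have /hasP[z _ zp] := has_prim_root n0 rn ur (eq_leq (esym sz)).
by exists z.
Qed.

Variables (N n : nat).
Hypothesis nN : (n <= N)%N.

(* The point is (-z, ..., -z^n, 0, ..., 0) with z a primitive (n+1)-st root of unity. *)
Lemma alternating_power_sums : exists v : 'I_N -> F,
  forall j, (0 < j <= n)%N -> (psym F N j).@[v] = (-1) ^+ j.-1.
Proof.
have [z zp] := primitive_root_exists (ltn0Sn n).
exists (fun i => if (i < n)%N then - z ^+ i.+1 else 0) => j /andP[j0 jn].
rewrite /psym raddf_sum /=.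
transitivity (\sum_(i < N | (i < n)%N) (- z ^+ i.+1) ^+ j).
  rewrite [RHS]big_mkcond; apply: eq_bigr => i _; rewrite rmorphXn /= mevalXU.
  by case: ifP => //; rewrite expr0n gtn_eqF.
rewrite -(big_ord_widen N (fun i => (- z ^+ i.+1) ^+ j)) //.
have zj : z ^+ j != 1.
  by rewrite -(prim_order_dvd zp) gtnNdvd.
have : (z ^+ j - 1) * \sum_(i < n.+1) (z ^+ j) ^+ i = 0.
  by rewrite -subrX1 -exprM mulnC exprM (prim_expr_order zp) expr1n subrr.
move/eqP; rewrite mulf_eq0 subr_eq0 (negPf zj) /= big_ord_recl expr0 => /eqP s0.
under eq_bigr do rewrite exprNn -exprM mulnC exprM.
rewrite -mulr_sumr; move: s0 => /eqP; rewrite addrC addr_eq0 => /eqP ->.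
by case: j j0 {jn zj} => // j _; rewrite exprS mulN1r mulNr mulrN1 opprK.
Qed.

(** Induction by Newton's identity: for [m >= 2] only the terms [j = m.-1] and [j = m] survive, and
    they cancel. *)
Lemma hsym_specialization : exists v : 'I_N -> F,
  forall m, (m <= n)%N -> (hsym F N m).@[v] = (m <= 1)%:R.
Proof.
have [v vp] := alternating_power_sums; exists v; elim/ltn_ind=> m IH mn.
have [->|m0] := posnP m; first by rewrite hsym0 rmorph1.
have := congr1 (meval v) (newton_hsym F N m); rewrite mevalZ [X in _ = X -> _]raddf_sum /=.
have mF : m%:R != 0 :> F by rewrite pnatr_eq0 -lt0n.
rewrite (eq_big_nat _ _ (F2 := fun j => (-1) ^+ j.-1 * (m - j <= 1)%:R)); last first.
  move=> j /andP[j0 jm]; rewrite mevalM vp ?j0 ?(leq_trans _ mn) // IH //.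
    by rewrite ltn_subrL j0.
  exact: leq_trans (leq_subr _ _) mn.
move=> e; apply: (mulfI mF); rewrite e.
case: m m0 {IH mn e mF} => [|[|m]] // _.
  by rewrite big_nat1 expr0 mul1r.
rewrite big_nat_recr //= big_nat_recr //= big_nat_cond big1 => [|j /andP[/andP[_ jm] _]].
  by rewrite add0r subSnn subnn !mulr1 mulr0 exprS mulN1r subrr.
by rewrite (_ : (m.+2 - j <= 1)%N = false) ?mulr0 //; lia.
Qed.

Lemma parts_gt1 (l : intpart n) : parts l != nseq n 1%N ->
  exists2 m, m \in parts l & (1 < m <= n)%N.
Proof.
move=> ne; have /and3P[_ l1 /eqP ln] := parts_is_part l.
have [/hasP[m ml m1]|/hasPn all1] := boolP (has (fun m => 1 < m)%N (parts l)).
  by exists m; rewrite // m1 -ln sumn_ge.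
case/eqP: ne; have e : parts l = nseq (size (parts l)) 1%N.
  apply/all_pred1P/allP=> m ml /=; rewrite eqn_leq (allP l1 _ ml) andbT leqNgt.
  exact: all1.
have sz : size (parts l) = n by rewrite -[RHS]ln [in RHS]e sumn_nseq mul1n.
by rewrite e sz.
Qed.

Lemma meval_hsymp (v : 'I_N -> F) (l : intpart n) :
    (forall m, (m <= n)%N -> (hsym F N m).@[v] = (m <= 1)%:R) ->
  (hsymp F N (parts l)).@[v] = (parts l == nseq n 1%N)%:R.
Proof.
move=> hv; rewrite /hsymp rmorph_prod /=.
have [e|/parts_gt1[m ml /andP[m1 mn]]] := eqVneq (parts l) (nseq n 1%N); last first.
  by rewrite (big_rem m) //= hv // leqNgt m1 mul0r.
rewrite e big_nseq; have [->//|n0] := posnP n.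
by rewrite hv // iter_mulr_1 expr1n.
Qed.

Lemma hsymp_coefficient_1n (c : intpart n -> F) (v : 'I_N -> F) (l : intpart n) :
    (forall m, (m <= n)%N -> (hsym F N m).@[v] = (m <= 1)%:R) ->
    parts l = nseq n 1%N ->
  (\sum_m c m *: hsymp F N (parts m)).@[v] = c l.
Proof.
move=> hv el; rewrite raddf_sum /= (bigD1 l) //= big1 ?addr0 => [|m ml].
  by rewrite mevalZ meval_hsymp // el eqxx mulr1.
rewrite mevalZ meval_hsymp // -el (inj_eq (@parts_inj n)) (negPf ml) mulr0.
by [].
Qed.

End Specialization.

(** * Permutation modules and virtual modules *)

Section PermutationModules.

Variables (F : numFieldType) (n : nat).

Section GSet.

Variables (X : finType) (act : 'S_n -> X -> X).
Hypothesis act1 : forall x, act 1%g x = x.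
Hypothesis actM : forall s t x, act (s * t)%g x = act t (act s x).

Definition gset_mx (s : 'S_n) : 'M[F]_#|X| :=
  \matrix_(a, b) (enum_val b == act s (enum_val a))%:R.

Lemma gset_mx_row (s : 'S_n) a :
  row a (gset_mx s) = row (enum_rank (act s (enum_val a))) 1%:M.
Proof.
by apply/rowP=> b; rewrite !mxE -(inj_eq enum_val_inj) enum_rankK eq_sym.
Qed.

Lemma gset_mx_repr : mx_repr [set: 'S_n]%G gset_mx.
Proof.
split=> [|s t _ _]; apply/row_matrixP=> a.
  by rewrite gset_mx_row act1 enum_valK.
rewrite row_mul gset_mx_row gset_mx_row -row_mul mul1mx gset_mx_row.
by rewrite enum_rankK actM.
Qed.

Definition gset_module : Smodule F n := Representation (MxRepresentation gset_mx_repr).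

Lemma gset_module_perm : is_permutation_module gset_module.
Proof.
exists 1%:M; first exact: unitmx1.
move=> s a; exists (enum_rank (act s (enum_val a))).
by rewrite -row_mul mul1mx -gset_mx_row.
Qed.

Lemma mxtrace_gset (s : 'S_n) : \tr (gset_module s) = #|[set x | act s x == x]|%:R.
Proof.
rewrite /mxtrace -sum1dep_card natr_sum [RHS]big_mkcond /=.
rewrite [RHS](reindex (@enum_val X X)) /=; last exact: onW_bij (enum_val_bij X).
by apply: eq_bigr => a _; rewrite mxE eq_sym; case: eqP.
Qed.

End GSet.

Lemma is_permutation_module_dadd (V W : Smodule F n) :
  is_permutation_module V -> is_permutation_module W ->
  is_permutation_module (dadd_grepr V W).
Proof.
move=> [A uA hA] [B uB hB]; exists (block_mx A 0 0 B).
  by rewrite unitmxE det_ublock unitrM -!unitmxE uA.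
move=> s i; rewrite /= -(splitK i); case: (split i) => j /=.
  have [j' ej] := hA s j; exists (lshift _ j'); rewrite !rowKu !row_row_mx !row0.
  by rewrite mul_row_block ej !mul0mx !mulmx0 !addr0.
have [j' ej] := hB s j; exists (rshift _ j'); rewrite !rowKd !row_row_mx !row0.
by rewrite mul_row_block ej !mul0mx !mulmx0 !add0r.
Qed.

(** The factor ['I_m] supplies [m] copies of the module on injective words. A permutation fixes a
    word exactly when it fixes all its letters. *)
Lemma injective_words_module (m d : nat) : exists2 V : Smodule F n,
  is_permutation_module V & forall s : 'S_n, \tr (V s) = (m * nfix s ^_ d)%N%:R.
Proof.
pose X := ('I_m * {t : d.-tuple 'I_n | uniq t})%type.
have uniq_act (s : 'S_n) (t : {t : d.-tuple 'I_n | uniq t}) :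
    uniq [tuple of [seq s a | a <- val t]].
  by rewrite map_inj_uniq ?(valP t) //; apply: perm_inj.
pose act (s : 'S_n) (x : X) : X :=
  (x.1, exist (fun t : d.-tuple 'I_n => uniq t) _ (uniq_act s x.2)).
have act1 x : act 1%g x = x.
  case: x => i t; congr (_, _); apply: val_inj; apply: val_inj => /=.
  by rewrite -[RHS]map_id; apply: eq_map => a; rewrite perm1.
have actM s t x : act (s * t)%g x = act t (act s x).
  congr (_, _); apply: val_inj; apply: val_inj => /=.
  by rewrite -map_comp; apply: eq_map => a; rewrite permM.
exists (gset_module act1 actM); first exact: gset_module_perm.
move=> s; rewrite mxtrace_gset; congr (_%:R).
have -> : nfix s = #|(fun i : 'I_n => s i == i)|.
  by apply: eq_card => i; rewrite inE.
rewrite -(card_uniq_tuples d (fun i : 'I_n => s i == i)) -[X in (X * _)%N](card_ord m).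
rewrite -cardsT -cardsX.
pose h (x : X) := (x.1, val x.2).
have h_inj : injective h by move=> [i t] [j u] [-> e]; congr (_, _); apply: val_inj.
rewrite -(card_imset _ h_inj); apply: eq_card => [[i t]]; rewrite !inE /=.
have fixE (u : d.-tuple 'I_n) : ([tuple of [seq s a | a <- u]] == u) = all (fun i : 'I_n => s i == i) u.
  rewrite -val_eqE /=; elim: (tval u) => //= a r IH.
  by rewrite eqseq_cons IH.
apply/imsetP/andP => [[[j u] + [_ ->]]|[at_t ut]].
  rewrite inE xpair_eqE eqxx /= -val_eqE /= fixE => fu.
  by split; [exact: fu | exact: (valP u)].
exists (i, exist (fun t : d.-tuple 'I_n => uniq t) t ut) => //.
by rewrite inE xpair_eqE eqxx /= -val_eqE /= fixE.
Qed.

Lemma sum_injective_words_module (m : nat -> nat) (r : seq nat) :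
  exists2 V : Smodule F n, is_permutation_module V
    & forall s : 'S_n, \tr (V s) = \sum_(d <- r) (m d * nfix s ^_ d)%N%:R.
Proof.
elim: r => [|d r [W pW tW]].
  exists grepr0; last by move=> s; rewrite big_nil mxtrace1.
  by exists 1%:M; [exact: unitmx1 | move=> s []].
have [V pV tV] := injective_words_module (m d) d.
exists (dadd_grepr V W); first exact: is_permutation_module_dadd.
by move=> s; rewrite big_cons -tV -tW [LHS]mxtrace_block.
Qed.

End PermutationModules.

(** * Virtual modules and their characters *)

Section VirtualModules.

Variables (F : numClosedFieldType) (n : nat).
Implicit Types u v : vmodule F n.

Definition vtrace u (s : 'S_n) : F := \tr (u.1 s) - \tr (u.2 s).

(** Adding the negative parts crosswise gives actual modules with equal traces, to which
    [mxtrace_eq_rsim] applies. *)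
Lemma veq_vtrace u v : (forall s, vtrace u s = vtrace v s) -> veq u v.
Proof.
move=> uv; apply: mxtrace_eq_rsim => s _; rewrite [LHS]mxtrace_block [RHS]mxtrace_block.
have -> : \tr (u.1 s) = \tr (v.1 s) - \tr (v.2 s) + \tr (u.2 s).
  by have := uv s; rewrite /vtrace => <-; rewrite subrK.
by rewrite addrAC subrK.
Qed.

Lemma vtrace_vmod (V : Smodule F n) s : vtrace (vmod V) s = \tr (V s).
Proof. by rewrite /vtrace /= mxtrace1 subr0. Qed.

Lemma vtrace_vopp u s : vtrace (vopp u) s = - vtrace u s.
Proof. by rewrite /vtrace opprB. Qed.

Lemma vtrace_vadd u v s : vtrace (vadd u v) s = vtrace u s + vtrace v s.
Proof.
by rewrite /vtrace [X in X - _]mxtrace_block [X in _ - X]mxtrace_block opprD addrACA.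
Qed.

Lemma vtrace_U k (s : 'S_n) : (0 < n)%N ->
  vtrace (U_ F n k.+1) s
    = ((nfix s)%:R - 1) ^+ k.+1 + (-1) ^+ k.+1 * ((nfix s)%:R - 1).
Proof.
move=> n0; rewrite vtrace_vadd vtrace_vmod mxtrace_tensor_pow mxtrace_reflection //.
congr (_ + _); elim: k.+1 => [|j IH]; first by rewrite vtrace_vmod mxtrace_reflection // mul1r.
by rewrite iterS vtrace_vopp IH exprS mulN1r mulNr.
Qed.

Lemma vchE N u : vch N u = n`!%:R^-1 *: \sum_(s : 'S_n) vtrace u s *: pcycle F N s.
Proof.
rewrite /vch !chE -scalerBr -sumrB; congr (_ *: _).
by apply: eq_bigr => s _; rewrite scalerBl.
Qed.

End VirtualModules.

Lemma hsymp_hook_part (F : numFieldType) (N n d : nat) : (d <= n)%N ->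
  hsymp F N (hook_part n d) = hsym F N 1 ^+ d * hsym F N (n - d).
Proof.
move=> dn; rewrite /hsymp /hook_part big_filter.
rewrite (eq_bigl (fun a => a != 0%N)) => [|a]; last by rewrite lt0n.
have big0 r : \prod_(a <- r | a != 0%N) hsym F N a = \prod_(a <- r) hsym F N a.
  rewrite big_mkcond; apply: eq_bigr => a _; case: eqP => // ->.
  by rewrite hsym0.
by rewrite big0 big_cons mulrC big_nseq iter_mulr_1.
Qed.

Lemma hook_part_is_part (n d : nat) : (d <= n)%N -> is_part n (hook_part n d).
Proof.
move=> dn; rewrite /hook_part /=.
have f1 : [seq a <- nseq d 1 | 0 < a]%N = nseq d 1%N.
  by apply/all_filterP; rewrite all_nseq orbT.
have s1 : sorted geq (nseq d 1%N) by elim: (d) => // -[|m] //.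
have a1 : all (leq 1) (nseq d 1%N) by rewrite all_nseq orbT.
rewrite f1; case: (posnP (n - d)) => [nd|nd].
  apply/and3P; split=> //; rewrite sumn_nseq mul1n eqn_leq dn.
  by rewrite -subn_eq0 nd.
apply/and3P; split.
- by case: (d) s1 nd => //= m -> ->.
- by rewrite /= nd.
- by rewrite /= sumn_nseq mul1n subnK.
Qed.

Theorem theorem39 (R : realType) (n k N : nat)
    (hn : (2 <= n)%N) (hk : (1 <= k)%N) (hN : (n <= N)%N) :
  let S : Smodule R[i] n := reflection R[i] n in
  let s : {mpoly R[i][N]} := schur R[i] N [:: n.-1; 1%N] in
  let U : vmodule R[i] n := U_ R[i] n k in
  let g := g_ n k in
  let hh (d : nat) : {mpoly R[i][N]} :=
    hsym R[i] N 1 ^+ d * hsym R[i] N (n - d) in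
  [/\ mx_rsim (homology R[i] n k k.-1) (tensor_pow S k),
      exists2 V : Smodule R[i] n, is_permutation_module V & veq U (vmod V),
      h_positive_on n
        (fun l => exists2 r : nat, (2 <= r <= n)%N & l = hook_part n r)
        (vch N U)
    & k = 1%N -> veq U (vzero R[i] n)] /\
  [/\ ch N S = s,
      ch N (tensor_pow S k) = kron_pow n s k,
      kron_pow n s k = \sum_(0 <= d < n.+1) (g d)%:~R *: hh d,
      kron_pow n s k = (-1) ^+ k.-1 *: s + vch N U
    & vch N U = \sum_(2 <= d < n.+1) (g d)%:~R *: hh d] /\
  [/\ forall m : nat, (2 <= m)%N -> (k <= n)%N -> (k <= m)%N ->
        forall d : nat, g d = g_ m k d,
      forall d : nat, (2 <= d <= k)%N -> 0 <= g d
    & forall d : nat, (k < d)%N -> g d = 0] /\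
  [/\ (g 2%N)%:~R = (1 + (-1) ^+ k) / 2 :> rat,
      (k <= n)%N -> g k.-1 = ('C(k.-1, 2))%:Z - 1
    & (k < n)%N -> g k = 1] /\
  (forall c : intpart n -> R[i],
     ch N (tensor_pow S k) = \sum_(l : intpart n) c l *: hsymp R[i] N (parts l) ->
     forall l : intpart n, parts l = nseq n 1%N ->
       c l = (if (n < k)%N then g n + g n.-1
              else if k == n then ('C(n.-1, 2))%:Z
              else if k == n.-1 then 1
              else 0)%:~R).
Proof.
case: n hn hN => [|[|n]] // _ hN; case: k hk => // k _ S s U g hh.
have chS : ch N S = s by rewrite /S ch_reflection // /s schur_hook.
have trS (x : 'S_n.+2) : \tr (S x) = (nfix x)%:R - 1 by apply: mxtrace_reflection.
have trSk (x : 'S_n.+2) : \tr (tensor_pow S k.+1 x) = ((nfix x)%:R - 1) ^+ k.+1.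
  by rewrite mxtrace_tensor_pow trS.
have gE (x : nat) : (x <= n.+2)%N ->
    (x%:R - 1) ^+ k.+1 = \sum_(0 <= d < n.+3) (g d)%:~R * (x ^_ d)%:R :> R[i].
  move=> xn; have := congr1 (fun z : int => z%:~R : R[i]) (@expr_pred_ffact n.+2 k.+1 x erefl erefl xn).
  rewrite rmorphXn rmorphB rmorph1 /= -pmulrn => ->; rewrite rmorph_sum.
  by apply: eq_bigr => d _; rewrite rmorphM /= -[(x ^_ d)%:~R]pmulrn.
(* The terms [d = 0] and [d = 1] of [gE] add up to -(-1)^(k+1) (x - 1), which the added reflection
   character cancels. *)
have gU (x : nat) : (x <= n.+2)%N ->
    (x%:R - 1) ^+ k.+1 + (-1) ^+ k.+1 * (x%:R - 1)
      = \sum_(2 <= d < n.+3) (g d)%:~R * (x ^_ d)%:R :> R[i].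
  move=> xn; rewrite gE // big_ltn // big_ltn // /g g_0 g_1 ffactn0 ffactn1.
  by rewrite !rmorphXn !rmorphN !rmorph1 exprS /=; ring.
have kronE : kron_pow n.+2 s k.+1 = ch N (tensor_pow S k.+1).
  have chSc : ch N S = class_sum N n.+2 (fun x => x%:R - 1 : R[i]) by exact: ch_class_sum.
  have chSkc : ch N (tensor_pow S k.+1) = class_sum N n.+2 (fun x => (x%:R - 1) ^+ k.+1 : R[i]).
    exact: ch_class_sum.
  by rewrite -chS chSc kron_pow_class_sum // chSkc.
have chSk : ch N (tensor_pow S k.+1) = \sum_(0 <= d < n.+3) (g d)%:~R *: hh d.
  by apply: ch_ffact => x; rewrite trSk gE // nfix_le.
have sE : s = hh 1%N - hh 0%N.
  by rewrite /s schur_hook /hh expr1 subn1 expr0 mul1r subn0.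
have vchU : vch N U = \sum_(2 <= d < n.+3) (g d)%:~R *: hh d.
  rewrite vchE /U.
  rewrite (eq_bigr (fun x : 'S_n.+2 =>
    (\sum_(2 <= d < n.+3) (g d)%:~R * (nfix x ^_ d)%:R) *: pcycle R[i] N x)); last first.
    by move=> x _; rewrite vtrace_U // gU // nfix_le.
  have split2 (V : nmodType) (G : nat -> V) :
      \sum_(2 <= d < n.+3) G d = \sum_(0 <= d < n.+3 | (2 <= d)%N) G d.
    rewrite [RHS]big_ltn_cond //= [RHS]big_ltn_cond //=.
    by rewrite [RHS]big_nat_cond [LHS]big_nat_cond; apply: eq_bigl => d; case: (2 <= d)%N.
  rewrite split2; apply: sum_pcycle_ffact => x; exact: split2.
have hsym_hook d : (d <= n.+2)%N -> hh d = hsymp R[i] N (hook_part n.+2 d).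
  by move=> dn; rewrite hsymp_hook_part.
have gk d : (k.+1 < d)%N -> g d = 0 by move=> kd; apply: g_gtk; rewrite kd.
have gpos d : (1 < d)%N -> 0 <= g d by apply: g_ge0.
split; [|split; [|split; [|split]]].
- split.
  + exact: homology_rsim.
  + have [V permV trV] := sum_injective_words_module R[i] n.+2 (fun d => `|g d|%N) (index_iota 2 n.+3).
    exists V => //; apply: veq_vtrace => x; rewrite vtrace_vmod trV vtrace_U // gU ?nfix_le //.
    apply: eq_big_nat => d /andP[d2 _].
    by rewrite natrM natr_absz ger0_norm ?gpos.
  (* A sum, because [hook_part] gives the same partition into ones for [d = n.+1] and [d = n.+2]. *)
  + pose c (l : intpart n.+2) : R[i] :=
      \sum_(2 <= d < n.+3 | hook_part n.+2 d == parts l) (g d)%:~R.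
    exists c; split=> [l|l|].
    * rewrite /c big_nat_cond; apply: sumr_ge0 => d /andP[/andP[d2 _] _].
      by rewrite ler0z gpos.
    * have [/hasP[d]|/hasPn no_d] := boolP (has (fun d => hook_part n.+2 d == parts l) (index_iota 2 n.+3)).
        by rewrite mem_index_iota ltnS => d2 /eqP <- _; exists d.
      by rewrite /c big_seq_cond big1 ?eqxx // => d /andP[/no_d /negP].
    rewrite vchU /c; under [RHS]eq_bigr do rewrite scaler_suml big_mkcond.
    rewrite exchange_big /=; apply: eq_big_nat => d /andP[_]; rewrite ltnS => dn.
    have [l el] := intpart_of (hook_part_is_part dn).
    rewrite -[RHS]big_mkcond [RHS](big_pred1 l) => [|m]; first by rewrite hsym_hook // el.
    by rewrite -el (inj_eq (@parts_inj _)) eq_sym.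
  + case=> k0; apply: veq_vtrace => x; rewrite vtrace_U // vtrace_vmod /= mxtrace1.
    by rewrite k0 !expr1 mulN1r subrr.
- split=> //; first by rewrite kronE.
  rewrite kronE chSk vchU sE big_ltn // [in LHS]big_ltn // /g g_0 g_1 addrA.
  congr (_ + _); rewrite !rmorphXn !rmorphN !rmorph1 exprS mulN1r scaleNr scalerBr addrC.
  by [].
- split=> [m m2 kn km d|d /andP[d2 _]|d]; [|exact: gpos|exact: gk].
  have [kd|dk] := ltnP k.+1 d; first by rewrite gk // g_gtk ?kd.
  by case: d dk => [|[|d]] //= dk; rewrite /g /g_ /= !(leq_trans dk).
- split=> [|kn|kn].
  + exact: g_2.
  + exact: g_subdiag.
  + by apply: g_diag; rewrite /= ltnW.
(* At the chosen point every h_l vanishes except that of the partition into ones, where it is 1; so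
   [c l] is the value of the characteristic there, whatever expansion [c] is given. *)
move=> c chc l el; have [v hv] := hsym_specialization R[i] hN.
have := congr1 (meval v) chc; rewrite (hsymp_coefficient_1n c hv el) => <-.
(* Only the last two values of [d] survive, since the other complete factor has degree at least 2
   for smaller [d]. *)
rewrite chSk big_nat_recr //= big_nat_recr //= big_nat_cond raddfD raddfD /= raddf_sum /=.
rewrite big1 ?add0r => [|d /andP[dn _]]; last first.
  rewrite mevalZ mevalM (hv (n.+2 - d)%N) ?leq_subr // (_ : (n.+2 - d <= 1)%N = false) ?mulr0 //.
  by lia.
have hhv d : (n < d <= n.+2)%N -> (hh d).@[v] = 1.
  move=> dn; rewrite mevalM rmorphXn /= !hv ?leq_subr // expr1n mul1r.
  by rewrite (_ : (n.+2 - d <= 1)%N) //; lia.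
rewrite !mevalZ !hhv ?ltnSn ?leqnSn ?leqnn //= !mulr1 addrC -rmorphD /=.
(* When the exponent equals the alphabet size, the diagonal coefficient 1 cancels the -1 in the
   subdiagonal one; below that size at most the coefficient at [d = n.+1] is nonzero. *)
congr (_%:~R); case: (ltngtP k.+1 n.+2) => [kn|//|[ek]].
  rewrite gk // add0r; case: eqP => [<-|/eqP ne]; first by apply: g_diag; rewrite /= ltnW.
  by rewrite gk // ltn_neqAle ne -ltnS.
by rewrite /g ek g_diag ?leqnn // (g_subdiag (k := n.+2)) ?leqnn //= addrC subrK.
Qed.
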